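(* Let $1<q<p$ be coprime integers, $k=\gcd(q-1,p)$, and let $K(p,q,h)$ be a primitive Legendrian grid number one knot in $L(p,q)$ with associated vertical length $v$. Let $K_0$ be a representative of $K(p,q,h)$ with special front projection and let $\Gamma\subset S^2$ be the Lagrangian projection of $K_0$. Then the crossings of $\Gamma$ are in one-to-one correspondence with the set of positive integers $$\{x \mid x<h \text{ and } k\mid x\}\ \cup\ \{y\mid y\le v\text{ and }k\mid y\},$$ where the elements of the two sets are counted separately (disjoint union). The number of connected components of $S^2-\Gamma$ is two more than the number of crossings.
   Context: **Lens space and projections.** View $S^3=\{(r_1,\theta_1,r_2,\theta_2): r_1^2+r_2^2=1\}\subset\mathbb{C}^2$ (polar coordinates) with contact form $r_1^2d\theta_1+r_2^2d\theta_2$, and let $F_{p,q}(r_1,\theta_1,r_2,\theta_2)=(r_1,\theta_1+\frac{2\pi q}{p},r_2,\theta_2+\frac{2\pi}{p})$. Then $L(p,q)=S^3/\langle F_{p,q}\rangle$ with the induced contact form; for $0<r_1<1$ the Reeb field is $\partial_{\theta_1}+\partial_{\theta_2}$. The Heegaard torus $\Sigma$ is the image of $r_1=r_2=1/\sqrt2$; it is parametrized by $0\le\theta_1<2\pi$ (mod $2\pi$), $0\le\theta_2\le\frac{2\pi}{p}$, with $(\theta_1,0)\sim(\theta_1+\frac{2\pi q}{p},\frac{2\pi}{p})$, and is divided into boxes: Box $c$ is $\frac{2\pi c}{p}\le\theta_1\le\frac{2\pi(c+1)}{p}$, $c=0,\dots,p-1$. Knots lie in the complement of the core curves $r_1=0$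 and $r_2=0$. The front projection is the projection to $\Sigma$ along $r_1$; a Legendrian knot is recovered from its front by $\frac{d\theta_2}{d\theta_1}=\frac{-r_1^2}{1-r_1^2}$. The Lagrangian projection is the map to the space of Reeb orbits of $L(p,q)$, a sphere $S^2$ with latitude $r_1\in[0,1]$ and azimuth $\phi=\frac pk(\theta_1-\theta_2)$ mod $2\pi$. **The special knot.** A grid number one diagram is the row of $p$ boxes with a basepoint in two of them. If the basepoints are $s$ boxes apart, $v(s)$ is the integer with $s+v(s)q\equiv 0\bmod p$, $1\le v(s)\le p-1$; put $h=s$ if $s+v(s)<p$, $h=p-s$ if $s+v(s)>p$, and $v=v(h)$ (so $h+v<p$). $K(p,q,h)$ is primitive (generates $H_1(L(p,q))$) iff $\gcd(h,p)=1$. $K(p,q,h)$ is the Legendrian isotopy class of the following special knot $K_0$. Place basepoints at the centers of Box $0$ and Box $h$; connect them by a horizontal line running right from Box $0$ with length $h$ boxes, then by a vertical line running down from Box $h$ with length $v$ boxes back to Box $0$. Add a basepoint at every box center the curve passes through, so that the curve consists of $h+v$ segments of equal length. Slide each basepoint slightly along the anti-diagonal of its box (the slope $1$ diagonal, on which $\theta_1-\theta_2$ is constant) so that the slopes of the $h+v$ straight segments are negative and strictly decrease as one moves along the curve starting rightward from Box $0$. Finally replace a small neighborhood of each basepoint by a curve interpolating smoothly and strictly monotonically between the two adjacent slopes. All perturbations are sufficiently small. This is a special front projection and $K_0$ is the Legendrian knot with this front. *)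

(* Defs.v *)
From HB Require Import structures.
From mathcomp Require Import all_boot all_order all_algebra.
From mathcomp Require Import complex generic_quotient.
From mathcomp Require Import all_classical all_reals all_analysis.
From mathcomp Require Import ring lra.

Set Implicit Arguments.
Unset Strict Implicit.
Unset Printing Implicit Defensive.

Import Normc Order.TTheory GRing.Theory Num.Theory.
Import numFieldNormedType.Exports.

Local Open Scope ring_scope.
Local Open Scope classical_set_scope.
Local Open Scope quotient_scope.

Section Lens.
Variable R : realType.
Local Notation C := (complex R).

Definition cis (t : R) : C := Complex (cos t) (sin t).

Lemma cis0 : cis 0 = 1.
Proof. by rewrite /cis cos0 sin0. Qed.

Lemma cisD (s t : R) : cis (s + t) = cis s * cis t.
Proof.
rewrite /cis cosD sinD.
by apply/eqP; rewrite eq_complex /= eqxx /= addrC [_ * sin t]mulrC mulrC.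
Qed.

Lemma cisX (t : R) (n : nat) : cis t ^+ n = cis (t *+ n).
Proof.
elim: n => [|n IHn]; first by rewrite cis0.
by rewrite exprS IHn mulrS cisD.
Qed.

Lemma cis_turns (n : nat) : cis ((pi : R) *+ 2 *+ n) = 1.
Proof. by rewrite -cisX /cis cos2pi sin2pi expr1n. Qed.

Lemma normc_cis (t : R) : normc (cis t) = 1.
Proof. by rewrite /= cos2Dsin2 sqrtr1. Qed.

Definition is_S3 (z : C * C) : bool := normc z.1 ^+ 2 + normc z.2 ^+ 2 == 1.

Definition S3 := {z : C * C | is_S3 z}.
HB.instance Definition _ := Choice.on S3.

Section Quotient.
Variables p q : nat.

Definition rot (z : C * C) : C * C :=
  (cis (2 * pi * q%:R / p%:R) * z.1, cis (2 * pi / p%:R) * z.2).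

Lemma rot_S3 (z : S3) : is_S3 (rot (val z)).
Proof.
by case: z => z; rewrite /is_S3 /= !normcM !normc_cis !mul1r.
Qed.

Definition Fpq (z : S3) : S3 := exist _ (rot (val z)) (rot_S3 z).

Lemma val_iterFpq n (z : S3) :
  val (iter n Fpq z) = (cis (2 * pi * q%:R / p%:R) ^+ n * (val z).1,
                      cis (2 * pi / p%:R) ^+ n * (val z).2).
Proof.
elim: n => [|n IHn]; first by rewrite !expr0 !mul1r; case: (val z).
by rewrite /= /rot /= IHn /= !exprS !mulrA.
Qed.

Lemma iterFpq_order (z : S3) : (0 < p)%N -> iter p Fpq z = z.
Proof.
move=> p0; apply/val_inj; rewrite val_iterFpq !cisX -[LHS]/(_, _).
have pN0 : p%:R != 0 :> R by rewrite pnatr_eq0 -lt0n.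
have -> : 2 * pi * q%:R / p%:R *+ p = pi *+ 2 *+ q :> R.
  by rewrite -[LHS]mulr_natr divfK// -[RHS]mulr_natr [2 * pi]mulr_natl.
have -> : 2 * pi / p%:R *+ p = pi *+ 2 *+ 1 :> R.
  by rewrite -[LHS]mulr_natr divfK// mulr1n mulr_natl.
by rewrite !cis_turns !mul1r; case: (val z).
Qed.

Definition same_orbit (z w : S3) : bool := `[< exists n, w = iter n Fpq z >].

Lemma Fpq_p0 (z : S3) : p = 0%N -> Fpq z = z.
Proof.
move=> p0; apply/val_inj; rewrite /= /rot p0 invr0 !mulr0 !cis0 !mul1r.
by case: (val z).
Qed.

Lemma same_orbit_equiv : equiv_class_of same_orbit.
Proof.
split.
- by move=> z; apply/asboolP; exists 0%N.
- suff H z w : same_orbit z w -> same_orbit w z by move=> z w; apply/idP/idP; exact: H.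
  move=> /asboolP[n ->]; apply/asboolP.
  have [p0|p0] := posnP p.
    by exists 0%N => /=; elim: n => //= n <-; rewrite Fpq_p0.
  exists (n * p.-1)%N; rewrite -iterD addnC -mulnS prednK//.
  by elim: n => //= n IHn; rewrite mulSn iterD -IHn iterFpq_order.
- move=> y x z /asboolP[m ->] /asboolP[n ->]; apply/asboolP.
  by exists (n + m)%N; rewrite iterD.
Qed.

Canonical same_orbit_rel := EquivRelPack same_orbit_equiv.

(* L(p,q) = S^3 / <Fpq> *)
Definition lens := {eq_quot same_orbit}.

Definition lens_pi (z : S3) : lens := \pi_lens z.

(* x is the point with polar coordinates (r1, th1, sqrt(1 - r1^2), th2);
   meant for 0 <= r1 <= 1. *)
Definition has_polar (x : lens) (r1 th1 th2 : R) : Prop :=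
  exists2 z : S3,
    val z = ((r1%:C)%C * cis th1, ((Num.sqrt (1 - r1 ^+ 2))%:C)%C * cis th2)
    & x = lens_pi z.

Definition S2 : set (R * R * R) :=
  [set u | u.1.1 ^+ 2 + u.1.2 ^+ 2 + u.2 ^+ 2 = 1].

(* The fibres of S^3 -> L(p,q) -> S^2 are the Reeb orbits.  With
   z = (r1 e^(i th1), r2 e^(i th2)) and k = gcd(q-1,p), the image of z is the
   point of azimuth phi = (p/k)(th1 - th2) and height r2^2 - r1^2 = 1 - 2 r1^2,
   hence at distance 2 r1 r2 from the axis; e below is e^(i phi).  On the cores
   (r1 r2 = 0) the image is a pole. *)
Definition lagr (z : C * C) : R * R * R :=
  let u := z.1 * conjc z.2 in
  let e := (u / ((normc u)%:C)%C) ^+ (p %/ gcdn (q - 1) p) in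
  (2 * normc u * complex.Re e, 2 * normc u * complex.Im e,
   normc z.2 ^+ 2 - normc z.1 ^+ 2).

Definition lagrangian_proj (x : lens) : R * R * R := lagr (val (repr x)).

Lemma lagr_rot (z : C * C) : (0 < p)%N -> (0 < q)%N -> lagr (rot z) = lagr z.
Proof.
move=> p0 q0; rewrite /lagr /rot /=.
set a := 2 * pi * q%:R / p%:R; set b := 2 * pi / p%:R.
have cc t : conjc (cis t) = cis (- t) by rewrite /cis cosN sinN.
have cM (x y : C) : conjc (x * y) = conjc x * conjc y by exact: rmorphM.
rewrite cM cc mulrACA -cisD.
rewrite !normcM !normc_cis !mul1r -[cis _ * _ / _]mulrA exprMn cisX.
set k := gcdn _ _.
have k0 : (0 < k)%N by rewrite gcdn_gt0 p0 orbT.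
have -> : (a - b) *+ (p %/ k) = pi *+ 2 *+ ((q - 1) %/ k) :> R.
  have kp : (k %| p)%N by exact: dvdn_gcdr.
  have kq : (k %| q - 1)%N by exact: dvdn_gcdl.
  have kN0 : k%:R != 0 :> R by rewrite pnatr_eq0 -lt0n.
  have pN0 : p%:R != 0 :> R by rewrite pnatr_eq0 -lt0n.
  rewrite -[LHS]mulr_natr -[RHS]mulr_natr !pchar0_natf_div //; try exact: pchar_num.
  by rewrite natrB// /a /b; field; rewrite kN0 pN0.
by rewrite cis_turns mul1r.
Qed.

Lemma lagrangian_proj_pi (z : S3) : (0 < p)%N -> (0 < q)%N ->
  lagrangian_proj (lens_pi z) = lagr (val z).
Proof.
move=> p0 q0; rewrite /lagrangian_proj /lens_pi.
have /eqP : \pi_lens z = \pi_lens (repr (\pi_lens z)) by rewrite reprK.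
rewrite eqmodE => /asboolP[n ->].
by elim: n => //= n <-; rewrite lagr_rot.
Qed.

Lemma lagrangian_proj_S2 (x : lens) : S2 (lagrangian_proj x).
Proof.
rewrite /lagrangian_proj; move: (repr x) => [z /= /eqP z1]; rewrite /S2 /lagr /=.
set u := z.1 * _; set e := ((u / _) ^+ _).
have nu : normc u = normc z.1 * normc z.2.
  by rewrite normcM; congr (_ * _); case: z.2 => a b /=; rewrite sqrrN.
have e1 : normc u != 0 -> complex.Re e ^+ 2 + complex.Im e ^+ 2 = 1.
  move=> u0.
  have : normc e = 1.
    rewrite /e; elim: (_ %/ _)%N => [|n IHn]; first by rewrite expr0 normc1.
    have nr : normc (normc u)%:C%C = normc u.
      by rewrite /= expr0n addr0 sqrtr_sqr ger0_norm// /normc; case: (u) => ? ?;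
         rewrite sqrtr_ge0.
    by rewrite exprS normcM IHn mulr1 normcM normcV nr divff.
  case: e => a b /= ab1.
  by rewrite -[LHS]sqr_sqrtr ?ab1 ?expr1n// addr_ge0 ?sqr_ge0.
transitivity ((normc z.1 ^+ 2 + normc z.2 ^+ 2) ^+ 2); last by rewrite z1 expr1n.
rewrite !exprMn -mulrDr; have [u0|/e1 ->] := eqVneq (normc u) 0; last first.
  by rewrite mulr1 nu; ring.
rewrite u0 expr0n mulr0 mul0r add0r.
by move: u0; rewrite nu => /eqP; rewrite mulf_eq0 => /orP[] /eqP ->; ring.
Qed.

End Quotient.
End Lens.

Section SpecialKnot.
Variable R : realType.

Definition smooth (f : R -> R) : Prop :=
  forall (n : nat) (x : R), derivable (derive1n n f) x 1.

Definition strictly_monotone_on (a b : R) (g : R -> R) : Prop :=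
  (forall x y, a <= x -> x < y -> y <= b -> g x < g y) \/
  (forall x y, a <= x -> x < y -> y <= b -> g y < g x).

Definition slope (P Q : R * R) : R := (Q.2 - P.2) / (Q.1 - P.1).

Variables p h v : nat.

Definition box : R := 2 * pi / p%:R.

(* Lift of the i-th basepoint to the (th1, th2)-plane, the universal cover of
   the Heegaard torus, whose deck group is spanned by (p box, 0) and
   (q box, box).  The rectilinear curve is developed in the plane: from the
   centre of Box 0, h boxes to the right, then v boxes down; d i is the slide
   along the anti-diagonal.  Indices i = 0 and i = h + v are two lifts of the
   basepoint of Box 0. *)
Definition basepoint (d : nat -> R) (i : nat) : R * R :=
  (box * ((minn i h)%:R + 2^-1) + d i, box * (2^-1 - (i - h)%:R) + d i).

(* All the slopes of a special front are negative and finite, so its lift is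
   the graph th2 = f th1 of a function f on R; one turn along the knot is the
   translation by (h box, - v box).  The neighbourhood of the i-th basepoint is
   the part of the curve over [lo i, hi i]; eps bounds all perturbations. *)
Definition special_front (eps : R) (f : R -> R) : Prop :=
  exists d lo hi : nat -> R,
  let n := (h + v)%N in
  let P := basepoint d in
  let m i := slope (P i) (P i.+1) in
  [/\ d n = d 0%N /\ (forall i, (i <= n)%N -> `|d i| < eps),
      (forall i, (i < n)%N -> m i < 0) /\
      (forall i j, (i < j)%N -> (j < n)%N -> m j < m i),
      [/\ lo n = lo 0%N + h%:R * box, hi n = hi 0%N + h%:R * box,
          forall i, (i <= n)%N ->
            (P i).1 - eps < lo i < (P i).1 /\ (P i).1 < hi i < (P i).1 + eps
        & forall i, (i < n)%N -> hi i < lo i.+1]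
    & [/\ smooth f,
          forall x, f (x + h%:R * box) = f x - v%:R * box,
          forall i, (i < n)%N -> forall x, hi i <= x <= lo i.+1 ->
            f x = (P i).2 + m i * (x - (P i).1)
        & forall i, (i <= n)%N ->
            strictly_monotone_on (lo i) (hi i) (derive1 f)]].

Variable q : nat.

(* The Legendrian knot whose front lifts to the graph of f. *)
Definition legendrian_of_front (f : R -> R) : set (lens R p q) :=
  [set x | exists th1 r1 : R,
     [/\ 0 < r1 < 1, derive1 f th1 = - r1 ^+ 2 / (1 - r1 ^+ 2)
       & has_polar x r1 th1 (f th1)]].

Definition special_knot (eps : R) (K : set (lens R p q)) : Prop :=
  exists2 f : R -> R, special_front eps f & K = legendrian_of_front f.

End SpecialKnot.

Section Crossings.
Variables (R : realType) (p q : nat) (K : set (lens R p q)).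

(* Gamma *)
Definition lagrangian_diagram : set (R * R * R) := @lagrangian_proj R p q @` K.

(* The points of Gamma over which lie at least two points of K. *)
Definition crossings : set (R * R * R) :=
  [set w | exists x y, [/\ K x, K y, x <> y,
     lagrangian_proj x = w & lagrangian_proj y = w]].

(* The connected components of S^2 - Gamma. *)
Definition regions : set (set (R * R * R)) :=
  let U := @S2 R `\` lagrangian_diagram in connected_component U @` U.

End Crossings.

Section Grid.
Local Open Scope nat_scope.

Definition vertical_length (p q s v : nat) : Prop :=
  0 < v < p /\ p %| s + v * q.

(* h and v are the horizontal and vertical lengths of a grid number one diagram
   with basepoints s boxes apart. *)
Definition grid_number_one (p q h v : nat) : Prop :=
  exists s vs, [/\ 0 < s < p, vertical_length p q s vs,
    (s + vs < p /\ h = s) \/ (p < s + vs /\ h = p - s)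
    & vertical_length p q h v].

(* Lifted to S^3, the knot runs from z to Fpq^(-v) z, so its class in
   H_1(L(p,q)) = <Fpq> = Z/p is that of -v; it is a generator iff gcd(v,p) = 1,
   i.e. (as h = - v q mod p) iff gcd(h,p) = 1. *)
Definition primitive (p h : nat) : bool := coprime h p.

Definition crossing_index (k h v : nat) : set (nat + nat) :=
  [set i | match i with
           | inl x => [&& 0 < x, x < h & k %| x]
           | inr y => [&& 0 < y, y <= v & k %| y]
           end].

End Grid.

(* Main.v *)
Require Import Defs.
From mathcomp Require Import all_boot all_order all_algebra.
From mathcomp Require Import complex generic_quotient.
From mathcomp Require Import all_classical all_reals all_analysis.
From mathcomp Require Import ring lra zify.

Set Implicit Arguments.
Unset Strict Implicit.
Unset Printing Implicit Defensive.

Import Normc Order.TTheory GRing.Theory Num.Theory.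
Import numFieldNormedType.Exports.

Local Open Scope ring_scope.
Local Open Scope classical_set_scope.
Local Open Scope card_scope.

(** The front is the graph th2 = f(th1) of a function with f' < 0, so the angle
    t = th1 - f(th1), which labels the Reeb orbits, increases strictly along the
    knot and parametrizes it.  In this parameter the Lagrangian projection has
    azimuth (p/k) t and a height H(t) that is an increasing function of the
    slope f'.  So Gamma is the graph of H wound around the sphere: the azimuth
    makes a turn while t increases by kappa = 2 pi k / p, and the knot closes up
    after T = 2 pi (h + v) / p, that is after M = (h + v) / k turns.  The M
    translates of H by multiples of kappa are the strands of Gamma.

    Sliding basepoints along anti-diagonals does not change th1 - th2; the i-th
    basepoint is therefore at t = 2 pi i / p exactly.  Near it the slope goes
    down, except at the basepoint of Box 0, where it goes back up from the last
    value to the first; elsewhere it is constant.  Hence H is unimodal: in each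
    period it rises strictly once and descends, in the weak sense, otherwise; over
    any angle 2 pi / p of the descent it goes down strictly ([front_unimodal]).

    Crossings.  A crossing is an equality H(c) = H(c + i kappa), 0 < i < M.  One
    of the two angles is on the rise and the other on the descent; on such pairs
    H(c) - H(c + i kappa) is strictly increasing and changes sign, so there is
    exactly one crossing for each i, and all of them are distinct
    ([crossing_exists], [crossing_at_uniq], [crossing_reduce],
    [crossing_level_inj]).  The two points of the front are different points of
    L(p,q): otherwise they would differ by whole numbers of boxes, and the front
    is too flat between them for that ([front_no_lattice_chord]).  Thus there
    are M - 1 crossings, one for each multiple of k strictly between 0 and
    h + v; those below h are the x, the others are the h + v - y.

    Regions.  The number of strands above a point of the sphere is locally
    constant off Gamma and takes the values 0, ..., M
    ([level_locally_constant]).  Its level sets are connected.  The levels 0 and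
    M are caps around the poles.  For 0 < i < M, the crossing of shift i at
    angle c pinches level i, and over c < t < c + kappa that level set is the
    zone between the lowest of i strands and the highest of the M - i others
    ([strand_dominance], [level_pinch]).  So there are M + 1 regions
    ([card_complement_components]), two more than crossings. *)

(** * Functions that rise once and descend once per period *)

Lemma periodic_intr (R : realType) (V : Type) (g : R -> V) (s : R) :
  (forall x, g (x + s) = g x) -> forall (m : int) x, g (x + m%:~R * s) = g x.
Proof.
move=> gs; have P n x : g (x + n%:R * s) = g x.
  elim: n x => [|n IHn] x; first by rewrite mul0r addr0.
  by rewrite -natr1 mulrDl mul1r addrA gs IHn.
case=> n x; first exact: P.
by rewrite NegzE mulrNz mulNr -(P n.+1 (x - _)) subrK.
Qed.

Section Unimodal.
Variable R : realType.
Implicit Types (t u w c z : R) (i j : nat).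

(** The height as a function of the angle: kappa is a turn of the azimuth, T a
    turn of the knot, [a, b] the neighbourhood of the basepoint of Box 0.  The
    descent may be constant on intervals shorter than kappa, whence uni_drop next
    to uni_dec. *)
Record unimodal (H : R -> R) (kappa T : R) (M : nat) (a b : R) : Prop := {
  uni_total : T = M%:R * kappa;
  uni_kappa : 0 < kappa;
  uni_turns : (0 < M)%N;
  uni_lt : a < b;
  uni_gt : b < a + T;
  uni_cont : continuous H;
  uni_period : forall t, H (t + T) = H t;
  uni_inc : forall s t, a <= s -> s < t -> t <= b -> H s < H t;
  uni_dec : forall s t, b <= s -> s <= t -> t <= a + T -> H t <= H s;
  uni_drop : forall s t, b <= s -> s + kappa <= t -> t <= a + T ->
    H t < H s
}.

Variables (H : R -> R) (kappa T : R) (M : nat) (a b : R).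
Hypothesis uniH : unimodal H kappa T M a b.

Let kappa_gt0 : 0 < kappa. Proof. exact: uni_kappa uniH. Qed.

Definition strand t i : R := H (t + i%:R * kappa).

Definition crossing_at i c : Prop :=
  [/\ a <= c <= b, b <= c + i%:R * kappa <= a + T & H c = strand c i].

Lemma shift_lt i j : (i < j)%N -> i%:R * kappa + kappa <= j%:R * kappa.
Proof.
move=> ij; have : (i.+1%:R : R) <= j%:R by rewrite ler_nat.
rewrite -natr1 => le_ij.
by rewrite -[X in _ + X]mul1r -mulrDl ler_wpM2r // ltW.
Qed.

Lemma shift_ltT i : (i < M)%N -> i%:R * kappa + kappa <= T.
Proof. by rewrite (uni_total uniH); exact: shift_lt. Qed.

Lemma shift_ge0 i : 0 <= i%:R * kappa.
Proof. by rewrite mulr_ge0 // ltW. Qed.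

Lemma shiftB i : (i <= M)%N -> (M - i)%:R * kappa = T - i%:R * kappa.
Proof. by move=> iM; rewrite natrB // mulrBl (uni_total uniH). Qed.

Lemma unimodal_periodz t (m : int) : H (t + m%:~R * T) = H t.
Proof. exact: (periodic_intr (uni_period uniH)). Qed.

(** The rise is injective, so the level determines the angle on the rise; two
    different shifts would then give two angles of the descent at least kappa
    apart at the same height.  In particular no three strands meet. *)
Lemma crossing_level_inj i j c d : (0 < i < M)%N -> (0 < j < M)%N ->
  crossing_at i c -> crossing_at j d -> H c = H d -> i = j /\ c = d.
Proof.
move=> iM jM [/andP[ac cb] /andP[bc ca] Hc] [/andP[ad db] /andP[bd da] Hd] Hcd.
have cd : c = d.
  have [lt|lt|//] := ltgtP c d.
    by have := uni_inc uniH ac lt db; rewrite Hcd ltxx.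
  by have := uni_inc uniH ad lt cb; rewrite Hcd ltxx.
split=> //; subst d; move: Hd; rewrite Hc /strand => Hij.
have [lt|lt|//] := ltngtP i j; have := shift_lt lt => D.
  have : H (c + j%:R * kappa) < H (c + i%:R * kappa).
    by apply: (uni_drop uniH bc) => //; rewrite -addrA lerD2l.
  by rewrite Hij ltxx.
have : H (c + i%:R * kappa) < H (c + j%:R * kappa).
  by apply: (uni_drop uniH bd) => //; rewrite -addrA lerD2l.
by rewrite Hij ltxx.
Qed.

(** When c moves up the rise, the height at c + i kappa, on the descent, does not
    increase. *)
Lemma crossing_at_uniq i c d : crossing_at i c -> crossing_at i d -> c = d.
Proof.
wlog lt_cd : c d / c < d.
  move=> W Hc Hd; have [lt|lt|//] := ltgtP c d; first exact: W.
  by apply/esym/W.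
move=> [/andP[ac cb] /andP[bc ca] Hc] [/andP[ad db] /andP[bd da] Hd].
have := uni_inc uniH ac lt_cd db.
have := uni_dec uniH bc _ da; rewrite lerD2r (ltW lt_cd) => /(_ isT).
by rewrite -[H (c + _)]/(strand c i) -[H (d + _)]/(strand d i) -Hc -Hd; lra.
Qed.

(** Intermediate values on the interval where c is on the rise and c + i kappa on
    the descent.  At its left end c is the minimum or c + i kappa is the maximum,
    and at its right end the reverse holds. *)
Lemma crossing_exists i : (0 < i < M)%N -> exists c, crossing_at i c.
Proof.
have k0 := kappa_gt0.
move=> /andP[i0 iM].
have D := shift_ltT iM; have D0 := shift_lt i0; rewrite mul0r add0r in D0.
have lt_ab := uni_lt uniH; have lt_ba := uni_gt uniH.
pose l := Num.max a (b - i%:R * kappa).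
pose r := Num.min b (a + T - i%:R * kappa).
have lr : l <= r.
  have e1 : a <= b by lra.
  have e2 : a <= a + T - i%:R * kappa by lra.
  have e3 : b - i%:R * kappa <= b by lra.
  have e4 : b - i%:R * kappa <= a + T - i%:R * kappa by lra.
  by rewrite ge_max !le_min e1 e2 e3 e4.
have al : a <= l by rewrite le_max lexx.
have bl : b - i%:R * kappa <= l by rewrite le_max lexx orbT.
have rb : r <= b by rewrite ge_min lexx.
have ra : r <= a + T - i%:R * kappa by rewrite ge_min lexx orbT.
pose D1 t := H t - strand t i.
have cD1 : continuous D1.
  move=> t; apply: cvgB; first exact: (uni_cont uniH).
  apply: (@continuous_comp _ _ _ (fun s => s + i%:R * kappa) H); last first.
    exact: (uni_cont uniH).
  by apply: cvgD; [exact: cvg_id|exact: cvg_cst].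
have HaT : H (a + T) = H a by rewrite (uni_period uniH).
have Dl : D1 l < 0.
  rewrite /D1 /strand subr_lt0 /l /Num.max; case: (ltP a (b - _)) => h.
    rewrite subrK; apply: (uni_inc uniH) => //; lra.
  rewrite -HaT; apply: (uni_drop uniH); lra.
have Dr : 0 < D1 r.
  rewrite /D1 /strand subr_gt0 /r /Num.min; case: (ltP b (a + T - _)) => h.
    apply: (uni_drop uniH); lra.
  rewrite subrK HaT; apply: (uni_inc uniH) => //; lra.
have [||c /[!in_itv]/= /andP[lc cr] Dc] := @IVT R D1 l r 0 lr.
- exact: continuous_subspaceT.
- by rewrite ge_min le_max (ltW Dl) (ltW Dr) orbT.
exists c; split; [lra|lra|].
by apply/eqP; rewrite -subr_eq0; apply/eqP.
Qed.

(** Two angles on the rise have different heights, and so do two angles on the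
    descent that are a multiple of kappa apart.  Hence each crossing has exactly
    one of its angles on the rise, from which the other is reached by the shift i
    or, modulo the period, by the shift M - i. *)
Lemma crossing_reduce i u : (0 < i < M)%N -> H u = strand u i ->
  exists (m : int) (j : nat) c, [/\ (0 < j < M)%N, crossing_at j c &
    u = c + m%:~R * T \/ u + i%:R * kappa = c + m%:~R * T].
Proof.
have k0 := kappa_gt0.
move=> /andP[i0 iM] Hu; have T_gt0 : 0 < T by have := uni_lt uniH; have := uni_gt uniH; lra.
have D := shift_ltT iM; have D0 := shift_lt i0; rewrite mul0r add0r in D0 D.
pose m := Num.floor ((u - a) / T); pose u' := u - m%:~R * T.
have /andP[au ua] : a <= u' < a + T.
  have := floor_itv ((u - a) / T); rewrite -/m ler_pdivlMr // ltr_pdivrMr //.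
  by rewrite intrD mulrDl mul1r /u' => /andP[? ?]; apply/andP; split; lra.
have Hu' : H u' = H (u' + i%:R * kappa).
  have := unimodal_periodz u' m; rewrite subrK => <-.
  have := unimodal_periodz (u' + i%:R * kappa) m.
  by rewrite [u' + _ + _]addrAC subrK => <-; exact: Hu.
have [w wD] : exists w, w = u' + i%:R * kappa - T by eexists.
have HwT : H w = H (u' + i%:R * kappa).
  by have := uni_period uniH w; rewrite wD subrK => <-.
have Hw : H w = H u' by rewrite HwT.
have uE : u = u' + m%:~R * T by rewrite subrK.
have wE : w + (M - i)%:R * kappa = u' by rewrite shiftB ?(ltnW iM) //; lra.
have [wT|wT] := leP (u' + i%:R * kappa) (a + T).
  have [ub|bu] := leP b u'.
    by have := @uni_drop _ _ _ _ _ _ uniH u' (u' + i%:R * kappa) ub; rewrite -Hu' ltxx; lra.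
  have [wb|bw] := ltP (u' + i%:R * kappa) b.
    by have := uni_inc uniH au _ (ltW wb); rewrite -Hu' ltxx; lra.
  exists m, i, u'; split; [by rewrite i0|by split; [lra|lra|]|by left].
have [wb|bw] := leP b w.
  by have := uni_drop uniH wb _ (ltW ua); rewrite Hw ltxx; lra.
have [ub|bu] := ltP u' b.
  by have := @uni_inc _ _ _ _ _ _ uniH w u'; rewrite Hw ltxx; lra.
exists (m + 1), (M - i)%N, w; split; first lia.
  by split; rewrite /strand ?wE; [lra|lra|].
by right; rewrite uE intrD mulrDl mul1r; lra.
Qed.

Section AtCrossing.
Variables (i : nat) (c : R).
Hypothesis (cross_c : crossing_at i c).

(** The angles c and c + i kappa cut the period into an arc through the maximum,
    where H is at least H c, and an arc through the minimum, where it is at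
    most H c.  Equality can only occur on the descent. *)
Lemma above_crossing u : c < u < c + i%:R * kappa ->
  H c <= H u /\ (H u = H c -> b <= u).
Proof.
have [/andP[ac cb] /andP[bc ca] Hc] := cross_c.
move=> /andP[cu uc]; have [bu|ub] := leP b u.
  by split=> //; rewrite Hc; apply: (uni_dec uniH) => //; exact: ltW.
have lt := uni_inc uniH ac cu (ltW ub).
by split; [exact: ltW|move=> E; rewrite E ltxx in lt].
Qed.

Lemma below_crossing w : c + i%:R * kappa < w < c + T ->
  H w <= H c /\ (H w = H c -> w <= a + T).
Proof.
have [/andP[ac cb] /andP[bc ca] Hc] := cross_c.
move=> /andP[cw wc]; have [wa|aw] := leP w (a + T).
  by split=> //; rewrite Hc; apply: (uni_dec uniH) => //; exact: ltW.
have : H (w - T) < H c by apply: (uni_inc uniH); lra.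
rewrite -(uni_period uniH (w - T)) subrK => lt.
by split; [exact: ltW|move=> E; rewrite E ltxx in lt].
Qed.

(** Over this range of t, the strands 0, ..., i - 1 are on the high arc and the
    strands i, ..., M - 1 on the low one.  If two of them had the same height,
    both would be on the descent, against uni_drop. *)
Lemma strand_dominance t j l : c < t < c + kappa ->
  (j < i)%N -> (i <= l < M)%N -> strand t l < strand t j.
Proof.
move=> /andP[ct tc] ji /andP[il lM].
have := shift_lt ji; have := shift_ltT lM; have := shift_lt (leq_trans ji il).
have := shift_ge0 j.
have il' : i%:R * kappa <= l%:R * kappa by rewrite ler_wpM2r ?ler_nat // ltW.
move=> j0 jl lT jI.
have [|w1 w2] := @below_crossing (t + l%:R * kappa); first lra.
have [|u1 u2] := @above_crossing (t + j%:R * kappa); first lra.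
rewrite /strand lt_neqAle (le_trans w1 u1) andbT; apply/eqP => E.
have Hu : H (t + j%:R * kappa) = H c by lra.
have Hw : H (t + l%:R * kappa) = H c by lra.
have := uni_drop uniH (u2 Hu) _ (w2 Hw); rewrite E ltxx; lra.
Qed.

Lemma strand_gt_crossing j : (0 < j < i)%N -> H c < strand c j.
Proof.
have k0 := kappa_gt0.
move=> /andP[j0 ji]; have := shift_lt ji; have := shift_lt j0; rewrite mul0r => j0' ji'.
have [|u1 u2] := @above_crossing (c + j%:R * kappa); first lra.
rewrite lt_neqAle u1 andbT; apply/eqP => E; have := u2 (esym E) => bu.
have [_ /andP[_ ca] Hc] := cross_c.
have := @uni_drop _ _ _ _ _ _ uniH _ (c + i%:R * kappa) bu.
by rewrite -[H (c + j%:R * _)]/(strand c j) -E Hc /strand ltxx; lra.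
Qed.

Lemma strand_lt_crossing j : (i < j < M)%N -> strand c j < H c.
Proof.
have k0 := kappa_gt0.
move=> /andP[ij jM]; have := shift_lt ij; have := shift_ltT jM; move=> jM' ij'.
have [|u1 u2] := @below_crossing (c + j%:R * kappa); first lra.
rewrite lt_neqAle u1 andbT; apply/eqP => E; have := u2 E => bu.
have [_ /andP[bc ca] Hc] := cross_c.
have := @uni_drop _ _ _ _ _ _ uniH _ (c + j%:R * kappa) bc.
by rewrite -[H (c + j%:R * _)]/(strand c j) E Hc /strand ltxx; lra.
Qed.

End AtCrossing.
End Unimodal.

(** * Longitude and height on the sphere *)

Section Circle.
Variable R : realType.
Implicit Types (s t z : R).

Lemma cos_sin_periodz s (m : int) :
  cos (s + m%:~R * (pi *+ 2)) = cos s /\ sin (s + m%:~R * (pi *+ 2)) = sin s.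
Proof.
by split; apply: periodic_intr; [exact: cosD2pi|exact: sinD2pi].
Qed.

Lemma cos_sin_inj s t : cos s = cos t -> sin s = sin t ->
  exists m : int, t = s + m%:~R * (pi *+ 2).
Proof.
move=> cE sE; have pi0 := @pi_gt0 R.
pose d := (t - s) / (pi *+ 2); pose m := Num.floor d; exists m.
have /andP[m1 m2] := floor_itv d.
have [r rE] : exists r, r = t - s - m%:~R * (pi *+ 2) by eexists.
have r0 : 0 <= r by move: m1; rewrite -/m ler_pdivlMr ?rE; lra.
have r2 : r < pi *+ 2.
  by move: m2; rewrite -/m ltr_pdivrMr ?rE ?intrD ?mulrDl; lra.
have cr : cos r = 1.
  have -> : r = t - s + (- m)%:~R * (pi *+ 2) by rewrite rE mulrNz mulNr.
  by rewrite (cos_sin_periodz _ _).1 cosB cE sE -!expr2 cos2Dsin2.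
suff : r = 0 by rewrite rE; lra.
have [rpi|pir] := leP r pi.
  by apply: cos_inj; rewrite ?in_itv /= ?cos0 //; apply/andP; split; lra.
suff : pi *+ 2 - r = 0 by lra.
apply: cos_inj; rewrite ?in_itv /=; [lra|lra|].
by rewrite cos0 addrC (@cosD2pi R) cosN.
Qed.

Lemma polar_angle (x y r : R) : 0 <= r -> x ^+ 2 + y ^+ 2 = r ^+ 2 ->
  exists s, x = r * cos s /\ y = r * sin s.
Proof.
rewrite le_eqVlt => /orP[/eqP <-|r0] E.
  exists 0; rewrite !mul0r; move/eqP: E; rewrite expr0n paddr_eq0 ?sqr_ge0 //.
  by rewrite !sqrf_eq0 => /andP[/eqP -> /eqP ->].
pose c := x / r.
have xE : x = r * c by rewrite /c; field; lra.
have r2 : 0 < r ^+ 2 by rewrite exprn_gt0.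
have yE : y ^+ 2 = r ^+ 2 * (1 - c ^+ 2) by rewrite mulrBr -exprMn -xE; lra.
have c1 : c ^+ 2 <= 1 by have := sqr_ge0 y; rewrite yE pmulr_rge0 //; lra.
have cb : -1 <= c <= 1 by rewrite -ler_norml -(@expr_le1 _ 2) // -normrX ger0_norm ?sqr_ge0.
have cc : cos (acos c) = c by rewrite acosK // in_itv.
have nyE : `|y| = r * sin (acos c).
  by rewrite sin_acos // -sqrtr_sqr yE sqrtrM ?sqr_ge0 // sqrtr_sqr gtr0_norm.
have [y0|y0] := lerP 0 y.
  by exists (acos c); rewrite cc -xE -nyE ger0_norm.
by exists (- acos c); rewrite cosN sinN cc -xE mulrN -nyE ltr0_norm // opprK.
Qed.

End Circle.

Section Cylinder.
Variable R : realType.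
Implicit Types (s t z : R).

(** The point of the unit sphere of longitude omega t and height z. *)
Definition cylinder (omega t z : R) : R * R * R :=
  (Num.sqrt (1 - z ^+ 2) * cos (omega * t),
   Num.sqrt (1 - z ^+ 2) * sin (omega * t), z).

Lemma sqr_le1 z : (z ^+ 2 <= 1) = (-1 <= z <= 1).
Proof. by rewrite -ler_norml -[in RHS](@expr_le1 _ 2 `|z|) // -normrX ger0_norm ?sqr_ge0. Qed.

Lemma sqr_lt1 z : (z ^+ 2 < 1) = (-1 < z < 1).
Proof. by rewrite -ltr_norml -[in RHS](@expr_lt1 _ 2 `|z|) // -normrX ger0_norm ?sqr_ge0. Qed.

Variables (omega kappa : R).
Hypothesis turn : omega * kappa = pi *+ 2.
Hypothesis kappa_gt0 : 0 < kappa.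
Local Notation cyl := (cylinder omega).

Lemma cylinder_S2 t z : -1 <= z <= 1 -> @S2 R (cyl t z).
Proof.
rewrite -sqr_le1 => z1; rewrite /S2 /= !exprMn -mulrDr cos2Dsin2 mulr1.
by rewrite sqr_sqrtr ?subr_ge0 // subrK.
Qed.

Lemma cylinder_periodz t z (m : int) : cyl (t + m%:~R * kappa) z = cyl t z.
Proof.
rewrite /cylinder; have -> : omega * (t + m%:~R * kappa) = omega * t + m%:~R * (pi *+ 2).
  by rewrite -turn; ring.
by have [-> ->] := cos_sin_periodz (omega * t) m.
Qed.

Lemma cylinder_inj t t' z z' : -1 < z < 1 -> cyl t z = cyl t' z' ->
  z' = z /\ exists m : int, t' = t + m%:~R * kappa.
Proof.
rewrite -sqr_lt1 => z1 [+ + zz']; subst z'.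
have s0 : Num.sqrt (1 - z ^+ 2) != 0 by rewrite gt_eqF // sqrtr_gt0 subr_gt0.
move=> /(mulfI s0) c /(mulfI s0) s; split=> //.
have [m tE] := cos_sin_inj c s; exists m.
have om0 : omega != 0.
  apply/eqP => o0; move: turn; rewrite o0 mul0r => /esym/eqP.
  by rewrite mulrn_eq0 /= gt_eqF // pi_gt0.
by apply: (mulfI om0); rewrite tE -turn; ring.
Qed.

Lemma turn_reduce t : exists m : int, 0 <= t + m%:~R * kappa < kappa.
Proof.
have k0 := kappa_gt0.
exists (- Num.floor (t / kappa)); have /andP[] := floor_itv (t / kappa).
rewrite ler_pdivlMr // ltr_pdivrMr // intrD mulrDl mul1r mulrNz mulNr.
by move=> *; apply/andP; split; lra.
Qed.

Lemma cylinder_reduce t z : exists2 t', 0 <= t' <= kappa & cyl t' z = cyl t z.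
Proof.
have [m /andP[m1 m2]] := turn_reduce t; exists (t + m%:~R * kappa).
  by rewrite m1 ltW.
exact: cylinder_periodz.
Qed.

Lemma cylinder_surj w : @S2 R w ->
  exists t z, -1 <= z <= 1 /\ w = cyl t z.
Proof.
case: w => [[x y] z]; rewrite /S2 /= => E.
have z1 : z ^+ 2 <= 1 by have := sqr_ge0 x; have := sqr_ge0 y; lra.
have [||s [-> ->]] := @polar_angle _ x y (Num.sqrt (1 - z ^+ 2)).
- exact: sqrtr_ge0.
- by rewrite sqr_sqrtr; lra.
exists (s / omega), z; split; first by rewrite -sqr_le1.
have om0 : omega != 0.
  apply/eqP => o0; move: turn; rewrite o0 mul0r => /esym/eqP.
  by rewrite mulrn_eq0 /= gt_eqF // pi_gt0.
by rewrite /cylinder [omega * _]mulrC divfK.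
Qed.

Lemma cylinder_pole t t' z : z ^+ 2 = 1 -> cyl t z = cyl t' z.
Proof. by move=> z1; rewrite /cylinder z1 subrr sqrtr0 !mul0r. Qed.

Lemma cylinder_continuous : continuous (fun tz : R * R => cyl tz.1 tz.2).
Proof.
move=> tz; rewrite /cylinder.
have c1 : {for tz, continuous (fun tz : R * R => Num.sqrt (1 - tz.2 ^+ 2))}.
  apply: (@continuous_comp _ _ _ (fun tz : R * R => 1 - tz.2 ^+ 2) (@Num.sqrt R));
    last exact: sqrt_continuous.
  apply: cvgB; first exact: cvg_cst.
  by rewrite /GRing.exp/=; apply: cvgM; exact: cvg_snd.
have c2 : {for tz, continuous (fun tz : R * R => omega * tz.1)}.
  by apply: cvgM; [exact: cvg_cst|exact: cvg_fst].
have cx : {for tz, continuous (fun tz : R * R => Num.sqrt (1 - tz.2 ^+ 2) * cos (omega * tz.1))}.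
  by apply: cvgM => //; exact: (continuous_comp c2 (@continuous_cos R _)).
have cy : {for tz, continuous (fun tz : R * R => Num.sqrt (1 - tz.2 ^+ 2) * sin (omega * tz.1))}.
  by apply: cvgM => //; exact: (continuous_comp c2 (@continuous_sin R _)).
exact: (cvg_pair (cvg_pair cx cy) cvg_snd).
Qed.

End Cylinder.

(** * The strands above a point of the sphere *)

Lemma sum_ltn_ord n i : (i <= n)%N -> (\sum_(j < n) (j < i)%N = i)%N.
Proof.
move=> le_in; rewrite -[RHS]card_ord -sum1_card (big_ord_widen n (fun=> 1%N)) //.
by rewrite [RHS]big_mkcond; apply: eq_bigr => j _; case: (_ < _)%N.
Qed.

Lemma ltn_sum_ord n (f g : 'I_n -> nat) j : (forall l, f l <= g l)%N ->
  (f j < g j)%N -> (\sum_l f l < \sum_l g l)%N.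
Proof.
move=> fg fgj; rewrite (bigD1 j) // [X in (_ < X)%N](bigD1 j) //=.
by rewrite -addSn leq_add // leq_sum.
Qed.

Section Regions.
Variable R : realType.
Implicit Types (s t u c z : R) (i j : nat).

Variables (H : R -> R) (kappa T : R) (M : nat) (a b omega : R).
Hypothesis uniH : unimodal H kappa T M a b.
Hypothesis turn : omega * kappa = pi *+ 2.
Hypothesis H_bound : forall t, -1 < H t < 1.

Local Notation cyl := (cylinder omega).
Local Notation str := (strand H kappa).

Let kappa_gt0 : 0 < kappa. Proof. exact: uni_kappa uniH. Qed.

Definition wound_graph : set (R * R * R) := range (fun t => cyl t (H t)).

Local Notation U := (@S2 R `\` wound_graph).

Definition off_strands t z : Prop := forall i, (i < M)%N -> str t i != z.

(** The locally constant function whose level sets turn out to be the regions. *)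
Definition level t z : nat := (\sum_(i < M) (z < str t i)%R)%N.

Lemma strand_continuous i : continuous (str^~ i).
Proof.
move=> t; apply: (@continuous_comp _ _ _ (fun s => s + i%:R * kappa) H); last first.
  exact: (uni_cont uniH).
by apply: cvgD; [exact: cvg_id|exact: cvg_cst].
Qed.

Lemma strandM t : str t M = str t 0.
Proof. by rewrite /strand -(uni_total uniH) (uni_period uniH) mul0r addr0. Qed.

Lemma strandD t n i : str (t + n%:R * kappa) i = str t (n + i).
Proof. by rewrite /strand natrD mulrDl addrA. Qed.

Lemma strand_mod t (m : int) : exists2 i, (i < M)%N & H (t + m%:~R * kappa) = str t i.
Proof.
have M0 := uni_turns uniH.
have M0' : (M%:Z != 0) by rewrite eqz_nat -lt0n.
have mM := divz_eq m M.
have := @ltz_pmod m M; rewrite ltz_nat => /(_ M0).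
have := modz_ge0 m M0'; case: (m %% M)%Z mM => // i mE _ iM.
exists i; first exact: iM.
rewrite /strand mE intrD intrM.
have MT : M%:~R * kappa = T by rewrite (uni_total uniH).
have -> : t + ((m %/ M)%Z%:~R * M%:~R + i%:~R) * kappa =
    t + i%:R * kappa + (m %/ M)%Z%:~R * T by rewrite -MT; ring.
exact: (unimodal_periodz uniH).
Qed.

Lemma level_turn z t : level (t + kappa) z = level t z.
Proof.
have S i : str (t + kappa) i = str t i.+1 by rewrite -add1n -strandD mul1r.
have SM := strandM t.
rewrite /level; case: M SM => [|m] SM; first by rewrite !big_ord0.
under eq_bigr do rewrite S.
by rewrite big_ord_recr [RHS]big_ord_recl /= SM addnC.
Qed.

Lemma level_periodz t (m : int) z : level (t + m%:~R * kappa) z = level t z.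
Proof. exact: (periodic_intr (level_turn z)). Qed.

Lemma off_wound_graph t z : ~ wound_graph (cyl t z) <-> off_strands t z.
Proof.
split=> [nT i iM|offz [s _ /(cylinder_inj turn (H_bound s))[zE [m tE]]]].
  apply/eqP => zE; apply: nT; exists (t + i%:R * kappa) => //.
  by rewrite -[H _]/(str t i) zE (cylinder_periodz turn t z i).
subst t; have [i iM Hi] := strand_mod (s + m%:~R * kappa) (- m).
have /eqP := offz i iM; apply; rewrite -Hi zE; congr H.
by rewrite mulrNz mulNr addrK.
Qed.

Lemma off_north t : off_strands t 1.
Proof. by move=> i _; rewrite lt_eqF //; have /andP[] := H_bound (t + i%:R * kappa). Qed.

Lemma off_south t : off_strands t (-1).
Proof. by move=> i _; rewrite gt_eqF //; have /andP[] := H_bound (t + i%:R * kappa). Qed.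

Lemma level_north t : level t 1 = 0%N.
Proof.
apply: big1 => i _; have /andP[_ lt1] := H_bound (t + i%:R * kappa).
by rewrite ltNge (ltW lt1).
Qed.

Lemma level_south t : level t (-1) = M.
Proof.
rewrite /level (eq_bigr (fun=> 1%N)) ?sum1_card ?card_ord // => i _.
by have /andP[-> _] := H_bound (t + i%:R * kappa).
Qed.

(** At a pole t is arbitrary, but there all the strands are on the same side. *)
Lemma level_cylinder t t' z z' : -1 <= z <= 1 -> cyl t z = cyl t' z' ->
  level t z = level t' z'.
Proof.
move=> /andP[]; rewrite le_eqVlt => /orP[/eqP <- _ [_ _ <-]|z0].
  by rewrite !level_south.
rewrite le_eqVlt => /orP[/eqP -> [_ _ <-]|z1 E]; first by rewrite !level_north.
have [|-> [m ->]] := cylinder_inj turn _ E; first by rewrite z0.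
by rewrite level_periodz.
Qed.

Lemma level_locally_constant (P : nat -> Prop) :
  open [set tz : R * R | off_strands tz.1 tz.2 /\ P (level tz.1 tz.2)].
Proof.
rewrite openE => -[t0 z0] /= [off0 P0]; rewrite /interior /=.
(* Positive as long as (t, z) is on the same side of strand i as (t0, z0). *)
pose g (i : 'I_M) (tz : R * R) := (str tz.1 i - tz.2) * (str t0 i - z0).
have gc (i : 'I_M) : continuous (g i).
  move=> tz; apply: cvgM; last exact: cvg_cst.
  apply: cvgB; last exact: cvg_snd.
  by apply: (@continuous_comp _ _ _ fst (str^~ i)); [exact: cvg_fst|exact: strand_continuous].
have : \forall tz \near (t0, z0), forall i : 'I_M, 0 < g i tz.
  pose F (i : 'I_M) := [set tz : R * R | 0 < g i tz].
  suff : \forall tz \near nbhs (t0, z0), forall i : 'I_M, F i tz by [].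
  apply: (@filter_forall _ _ F (nbhs (t0, z0))) => i.
  have g0 : 0 < g i (t0, z0).
    by rewrite /g /= -expr2 lt_neqAle sqr_ge0 andbT eq_sym sqrf_eq0 subr_eq0 off0.
  exact: (@cvgr_gt _ _ _ _ _ _ (gc i (t0, z0)) _ g0).
apply: filterS => -[t z] /= gt0.
have side i : (i < M)%N -> (str t i != z) /\ (z < str t i) = (z0 < str t0 i).
  move=> iM; have := gt0 (Ordinal iM); rewrite /g /= => g0; split.
    by apply/eqP => E; move: g0; rewrite E subrr mul0r ltxx.
  by apply/idP/idP => h; move: g0; [rewrite pmulr_rgt0|rewrite pmulr_lgt0]; rewrite subr_gt0.
split; first by move=> i /side[].
suff -> : level t z = level t0 z0 by [].
by apply: eq_bigr => i _; have [_ ->] := side _ (ltn_ord i).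
Qed.

(** Off the graph, this closed set is the union of the levels in P, and its
    version for the negation of P is the complement of that union; so each union
    of levels is both open and closed off the graph. *)
Definition graph_or_level (P : nat -> Prop) : set (R * R * R) :=
  [set w | exists t z, [/\ -1 <= z <= 1, w = cyl t z & off_strands t z -> P (level t z)]].

(** The image of a compact rectangle minus an open set. *)
Lemma graph_or_level_closed P : closed (graph_or_level P).
Proof.
pose K : set (R * R) := `[0, kappa] `*` `[-1, 1].
pose O := [set tz : R * R | off_strands tz.1 tz.2 /\ ~ P (level tz.1 tz.2)].
have -> : graph_or_level P = (fun tz => cyl tz.1 tz.2) @` (K `&` ~` O).
  apply/seteqP; split=> [w [t [z [z1 -> Pz]]]|w [[t z] /= [[_ z1] nO] <-]].
    have [t' t'k cE] := cylinder_reduce turn kappa_gt0 t z.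
    exists (t', z) => //; split; first by split; rewrite /= in_itv.
    move=> [/= /off_wound_graph]; rewrite cE => /off_wound_graph offz; apply.
    by rewrite (level_cylinder z1 cE); exact: Pz.
  exists t, z; split; [by move: z1; rewrite /= in_itv|by []|].
  by move=> offz; apply: contrapT => nP; apply: nO.
apply: compact_closed; first exact: norm_hausdorff.
apply: continuous_compact.
  by apply: continuous_subspaceT; exact: cylinder_continuous.
apply: compact_closedI.
  by apply: compact_setX; exact: segment_compact.
exact/open_closedC/(@level_locally_constant (fun n => ~ P n)).
Qed.

Lemma graph_or_levelE P t z : -1 <= z <= 1 -> off_strands t z ->
  graph_or_level P (cyl t z) <-> P (level t z).
Proof.
move=> z1 offz; split=> [[t' [z' [z1' cE Pz]]]|Pz]; last by exists t, z.
rewrite (level_cylinder z1 cE); apply: Pz.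
by apply/off_wound_graph; rewrite -cE; apply/off_wound_graph.
Qed.

Lemma complement_cylinder w : U w -> exists t z, [/\ -1 <= z <= 1, off_strands t z & w = cyl t z].
Proof.
move=> [/(cylinder_surj turn)[t [z [z1 ->]]] /off_wound_graph offz].
by exists t, z.
Qed.

Lemma cylinder_complement t z : -1 <= z <= 1 -> off_strands t z -> U (cyl t z).
Proof. by move=> z1 /off_wound_graph ?; split=> //; exact: cylinder_S2. Qed.

Lemma component_level t z t' z' : -1 <= z <= 1 -> off_strands t z ->
  -1 <= z' <= 1 -> off_strands t' z' ->
  connected_component U (cyl t z) (cyl t' z') -> level t' z' = level t z.
Proof.
move=> z1 offz z1' offz' [C [Cw CU Cconn] Cw'].
pose P n := n = level t z.
suff : C `&` graph_or_level P = C.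
  by move=> CE; move: Cw'; rewrite -CE => -[_ /(graph_or_levelE _ z1' offz')].
apply: Cconn.
- by exists (cyl t z); split=> //; apply/graph_or_levelE.
- exists (~` graph_or_level (fun n => ~ P n)).
    by apply: closed_openC; exact: graph_or_level_closed.
  apply/seteqP; split=> w [Cw0 Pw]; split=> //;
    have [s [y [y1 offy wE]]] := complement_cylinder (CU _ Cw0); move: Pw; rewrite wE.
    by move=> /(graph_or_levelE _ y1 offy) ? /(graph_or_levelE _ y1 offy).
  move=> nP; apply/graph_or_levelE => //; apply: contrapT => nP'.
  by apply: nP; apply/graph_or_levelE.
- by exists (graph_or_level P) => //; exact: graph_or_level_closed.
Qed.

Lemma path_component (tau zeta : R -> R) : continuous tau -> continuous zeta ->
  (forall s, 0 <= s <= 1 -> -1 <= zeta s <= 1 /\ off_strands (tau s) (zeta s)) ->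
  connected_component U (cyl (tau 0) (zeta 0)) (cyl (tau 1) (zeta 1)).
Proof.
move=> ct cz inU; pose f s := cyl (tau s) (zeta s).
exists (f @` `[0, 1]); last by exists 1 => //=; rewrite in_itv /= ler01 lexx.
split.
- by exists 0 => //=; rewrite in_itv /= ler01 lexx.
- by move=> w [s /=]; rewrite in_itv => /inU[z1 offz] <-; exact: cylinder_complement.
apply: connected_continuous_connected; first exact: segment_connected.
apply: continuous_subspaceT => s.
apply: (@continuous_comp _ _ _ (fun s => (tau s, zeta s)) (fun tz => cyl tz.1 tz.2)).
  exact: (cvg_pair (ct s) (cz s)).
exact: cylinder_continuous.
Qed.

Lemma affine_continuous (x y : R) : continuous (fun s : R => x + s * y).
Proof.
move=> s; apply: cvgD; first exact: cvg_cst.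
by apply: cvgM; [exact: cvg_id|exact: cvg_cst].
Qed.

Lemma level_eq0 t z : off_strands t z -> level t z = 0%N ->
  forall i, (i < M)%N -> str t i < z.
Proof.
move=> offz /eqP; rewrite /level sum_nat_eq0 => /forallP lz i iM.
by have := lz (Ordinal iM); rewrite /= eqb0 -leNgt le_eqVlt (negPf (offz i iM)).
Qed.

Lemma level_eqM t z : off_strands t z -> level t z = M ->
  forall i, (i < M)%N -> z < str t i.
Proof.
move=> offz lz i iM; apply: contraT => nz.
suff : (level t z < M)%N by rewrite lz ltnn.
rewrite -[X in (_ < X)%N](sum_ltn_ord (leqnn M)).
apply: (@ltn_sum_ord _ _ _ (Ordinal iM)) => [j|/=].
  by rewrite ltn_ord; case: (_ < _).
by rewrite (negPf nz) iM.
Qed.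

(** All strands are below the point: go up its meridian. *)
Lemma component_north t z : -1 <= z <= 1 -> off_strands t z -> level t z = 0%N ->
  connected_component U (cyl t z) (cyl 0 1).
Proof.
move=> /andP[z0 z1] offz l0.
have := @path_component (fun=> t) (fun s => z + s * (1 - z)) _ (@affine_continuous _ _).
rewrite mul0r addr0 mul1r subrKC (cylinder_pole _ 0 t) ?expr1n //; apply.
  by move=> s; exact: cvg_cst.
move=> s /andP[s0 s1]; have z' : 0 <= 1 - z by lra.
have := mulr_ge0 s0 z'; have s1' : 0 <= 1 - s by lra.
have := mulr_ge0 s1' z' => h1 h2; split; first by apply/andP; split; lra.
by move=> i iM; rewrite lt_eqF //; have := level_eq0 offz l0 iM; lra.
Qed.

Lemma component_south t z : -1 <= z <= 1 -> off_strands t z -> level t z = M ->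
  connected_component U (cyl t z) (cyl 0 (-1)).
Proof.
move=> /andP[z0 z1] offz l0.
have := @path_component (fun=> t) (fun s => z + s * (-1 - z)) _ (@affine_continuous _ _).
rewrite mul0r addr0 mul1r subrKC (cylinder_pole _ 0 t) ?sqrrN ?expr1n //; apply.
  by move=> s; exact: cvg_cst.
move=> s /andP[s0 s1]; have z' : 0 <= z + 1 by lra.
have := mulr_ge0 s0 z'; have s1' : 0 <= 1 - s by lra.
have := mulr_ge0 s1' z' => h1 h2; split; first by apply/andP; split; lra.
by move=> i iM; rewrite gt_eqF //; have := level_eqM offz l0 iM; lra.
Qed.

End Regions.

(** * The regions cut out by a wound graph *)

Section Gaps.
Variable R : realType.
Implicit Types (s t u c z : R) (i j : nat).

Variables (H : R -> R) (kappa T : R) (M : nat) (a b omega : R).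
Hypothesis uniH : unimodal H kappa T M a b.
Hypothesis turn : omega * kappa = pi *+ 2.
Hypothesis H_bound : forall t, -1 < H t < 1.

Local Notation cyl := (cylinder omega).
Local Notation str := (strand H kappa).
Local Notation U := (@S2 R `\` wound_graph H omega).
Local Notation off_strands := (off_strands H kappa M).
Local Notation level := (level H kappa M).

Let kappa_gt0 : 0 < kappa. Proof. exact: uni_kappa uniH. Qed.

Section Gap.
Variables (i : nat) (c : R).
Hypotheses (i_lt : (0 < i < M)%N) (cross_c : crossing_at H kappa T a b i c).

(** The curves that bound the region of level i over one turn.  The default
    values are the heights of the poles, beyond all strands. *)
Definition gap_ceiling t : R := \big[Num.min/1]_(j < i) str t j.
Definition gap_floor t : R := \big[Num.max/-1]_(j < M | (i <= j)%N) str t j.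

Lemma gap_ceiling_continuous : continuous gap_ceiling.
Proof.
apply: continuous_big => [|j _]; first exact: min_continuous.
exact: (strand_continuous uniH).
Qed.

Lemma gap_floor_continuous : continuous gap_floor.
Proof.
apply: continuous_big => [|j _]; first exact: max_continuous.
exact: (strand_continuous uniH).
Qed.

Lemma lt_gap_ceiling t z : z < 1 ->
  (forall j, (j < i)%N -> z < str t j) <-> z < gap_ceiling t.
Proof.
move=> z1; split=> [h|/bigmin_gtP[_ h] j ji]; last exact: (h (Ordinal ji)).
by apply: lt_bigmin => // j _; exact: h.
Qed.

Lemma gap_floor_lt t z : -1 < z ->
  (forall j, (i <= j < M)%N -> str t j < z) <-> gap_floor t < z.
Proof.
move=> z1; split=> [h|/bigmax_ltP[_ h] j /andP[ij jM]]; last exact: (h (Ordinal jM)).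
by apply: bigmax_lt => // j ij; apply: h; rewrite ij ltn_ord.
Qed.

Lemma gap_floor_geN1 t : -1 <= gap_floor t.
Proof. exact: bigmax_ge_id. Qed.

Lemma gap_ceiling_le1 t : gap_ceiling t <= 1.
Proof. exact: bigmin_le_id. Qed.

Lemma gap_floor_lt_ceiling t : c < t < c + kappa -> gap_floor t < gap_ceiling t.
Proof.
move=> tc; apply: bigmax_lt => [|l il].
  by apply: lt_bigmin => [|j _]; [lra|have /andP[] := H_bound (t + j%:R * kappa)].
apply: lt_bigmin => [|j _]; first by have /andP[] := H_bound (t + l%:R * kappa).
by have := strand_dominance uniH cross_c tc (ltn_ord j) (introT andP (conj il (ltn_ord l))).
Qed.

Lemma between_off t z : gap_floor t < z < gap_ceiling t -> off_strands t z /\ level t z = i.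
Proof.
move=> /andP[lz zu]; have z1 : -1 < z := le_lt_trans (gap_floor_geN1 t) lz.
have z2 : z < 1 := lt_le_trans zu (gap_ceiling_le1 t).
move/(gap_floor_lt _ z1): lz => lz; move/(lt_gap_ceiling _ z2): zu => zu.
have /andP[i0 iM] := i_lt; split.
  move=> j jM; have [ji|ij] := ltnP j i; first by rewrite gt_eqF // zu.
  by rewrite lt_eqF // lz // ij.
rewrite -[RHS](sum_ltn_ord (ltnW iM)); apply: eq_bigr => j _.
have [ji|ij] := ltnP j i; first by rewrite zu.
by rewrite ltNge (ltW (lz j _)) // ij ltn_ord.
Qed.

(** If one of the strands 0, ..., i - 1 were below z, then by dominance so would
    be all the strands i, ..., M - 1, leaving fewer than i strands above z;
    likewise on the other side. *)
Lemma level_between t z : c < t < c + kappa -> -1 < z < 1 -> off_strands t z ->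
  level t z = i -> gap_floor t < z < gap_ceiling t.
Proof.
move=> tc /andP[z0 z1] offz lv; have /andP[i0 iM] := i_lt.
have dom j l := @strand_dominance _ _ _ _ _ _ _ uniH _ _ cross_c t j l tc.
apply/andP; split; [apply/(gap_floor_lt _ z0)|apply/(lt_gap_ceiling _ z1)].
  move=> l /andP[il lM]; apply: contraT; rewrite -leNgt le_eqVlt eq_sym (negPf (offz _ lM)) /=.
  move=> zl; suff : (i < level t z)%N by rewrite lv ltnn.
  rewrite -[X in (X < _)%N](sum_ltn_ord (ltnW iM)).
  apply: (@ltn_sum_ord _ _ _ (Ordinal lM)) => [j|/=]; last by rewrite zl [(l < i)%N]ltnNge il.
  have [ji|//] := ltnP j i; have := dom j l ji; rewrite il lM => /(_ isT).
  by move=> /(lt_trans zl) ->.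
move=> j ji; have jM := ltn_trans ji iM.
apply: contraT; rewrite -leNgt le_eqVlt (negPf (offz _ jM)) /=.
move=> zl; suff : (level t z < i)%N by rewrite lv ltnn.
rewrite -[X in (_ < X)%N](sum_ltn_ord (ltnW iM)).
apply: (@ltn_sum_ord _ _ _ (Ordinal jM)) => [l|/=]; last by rewrite ji ltNge (ltW zl).
have [//|il] := ltnP l i; first by case: (_ < _).
have := dom j l ji; rewrite il ltn_ord => /(_ isT) lj.
by rewrite ltNge (ltW (lt_trans lj zl)).
Qed.

Lemma strand0 t : str t 0 = H t.
Proof. by rewrite /strand mul0r addr0. Qed.

(** At angle c the strands 0 and i meet, with the strands 1, ..., i - 1 strictly
    above and i + 1, ..., M - 1 strictly below: under the meeting point there are
    at least i + 1 strands above, and over it at most i - 1. *)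
Lemma level_pinch z : off_strands c z -> level c z <> i.
Proof.
have /andP[i0 iM] := i_lt; have [_ _ Hc] := cross_c.
have M0 := ltn_trans i0 iM.
move=> offz lv; have := offz _ M0; rewrite strand0 neq_lt => /orP[cz|zc].
  suff : (level c z < i)%N by rewrite lv ltnn.
  rewrite -[X in (_ < X)%N](sum_ltn_ord (ltnW iM)).
  apply: (@ltn_sum_ord _ _ _ (Ordinal M0)) => [l|/=]; last first.
    by rewrite i0 ltNge strand0 (ltW cz).
  have [//|] := ltnP l i; first by case: (_ < _).
  rewrite leq_eqVlt => /orP[/eqP <-|il]; first by rewrite -Hc ltNge (ltW cz).
  rewrite ltNge (ltW (lt_trans _ cz)) //.
  by apply: (strand_lt_crossing uniH cross_c); rewrite il ltn_ord.
suff : (i < level c z)%N by rewrite lv ltnn.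
rewrite -[X in (X < _)%N](sum_ltn_ord (ltnW iM)).
apply: (@ltn_sum_ord _ _ _ (Ordinal iM)) => [l|/=]; last by rewrite ltnn -Hc zc.
have [li|//] := ltnP l i.
have [->|l0] := posnP l; first by rewrite strand0 zc.
rewrite (lt_trans zc) //.
by apply: (strand_gt_crossing uniH cross_c); rewrite l0 li.
Qed.

(** Follow a straight segment in the coordinates t and (position between floor
    and ceiling, from 0 to 1). *)
Lemma component_between t z t' z' : c < t < c + kappa -> c < t' < c + kappa ->
  gap_floor t < z < gap_ceiling t -> gap_floor t' < z' < gap_ceiling t' ->
  connected_component U (cyl t z) (cyl t' z').
Proof.
move=> tc tc' /andP[lz zu] /andP[lz' zu'].
have gap := gap_floor_lt_ceiling tc; have gap' := gap_floor_lt_ceiling tc'.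
pose r := (z - gap_floor t) / (gap_ceiling t - gap_floor t).
pose r' := (z' - gap_floor t') / (gap_ceiling t' - gap_floor t').
have [r0 r1] : 0 < r /\ r < 1 by rewrite /r ltr_pdivrMr ?divr_gt0; lra.
have [r0' r1'] : 0 < r' /\ r' < 1 by rewrite /r' ltr_pdivrMr ?divr_gt0; lra.
pose tau s := t + s * (t' - t).
pose zeta s := gap_floor (tau s) + (r + s * (r' - r)) * (gap_ceiling (tau s) - gap_floor (tau s)).
have ct : continuous tau by exact: affine_continuous.
have cf : continuous (gap_floor \o tau).
  by move=> s; apply: continuous_comp; [exact: ct|exact: gap_floor_continuous].
have cc : continuous (gap_ceiling \o tau).
  by move=> s; apply: continuous_comp; [exact: ct|exact: gap_ceiling_continuous].
have cz : continuous zeta.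
  move=> s; apply: cvgD; first exact: cf.
  apply: cvgM; first exact: affine_continuous.
  by apply: cvgB; [exact: cc|exact: cf].
have E0 : tau 0 = t by rewrite /tau; lra.
have E1 : tau 1 = t' by rewrite /tau; lra.
have -> : cyl t z = cyl (tau 0) (zeta 0).
  rewrite /zeta E0 mul0r addr0 /r divfK; last lra.
  by rewrite addrC subrK.
have -> : cyl t' z' = cyl (tau 1) (zeta 1).
  rewrite /zeta E1 mul1r [r + _]addrC subrK /r' divfK; last lra.
  by rewrite addrC subrK.
apply: (path_component uniH turn H_bound ct cz) => s /andP[s0 s1].
have convex x y lo up : lo < x < up -> lo < y < up -> lo < x + s * (y - x) < up.
  move=> /andP[x1 x2] /andP[y1 y2].
  have -> : x + s * (y - x) = (1 - s) * x + s * y by ring.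
  have [->|s0'] := eqVneq s 0; first by rewrite subr0 mul1r mul0r addr0 x1.
  have s0'' : 0 < s by rewrite lt_neqAle eq_sym s0'.
  have s1' : 0 <= 1 - s by lra.
  have := ler_wpM2l s1' (ltW x1); have := ler_wpM2l s1' (ltW x2).
  have := ltr_pM2l s0'' lo y; have := ltr_pM2l s0'' y up; rewrite y1 y2.
  by move=> *; apply/andP; split; lra.
have tauc : c < tau s < c + kappa by exact: convex.
have /andP[q0 q1] : 0 < r + s * (r' - r) < 1 by apply: convex; apply/andP.
have g : 0 < gap_ceiling (tau s) - gap_floor (tau s) by rewrite subr_gt0 gap_floor_lt_ceiling.
have zb : gap_floor (tau s) < zeta s < gap_ceiling (tau s).
  have := mulr_gt0 q0 g; have := ltr_pM2r g (r + s * (r' - r)) 1.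
  by rewrite q1 mul1r /zeta => *; apply/andP; split; lra.
split; last by have [] := between_off zb.
have := gap_floor_geN1 (tau s); have := gap_ceiling_le1 (tau s).
by move: zb => /andP[]; lra.
Qed.

Lemma gap_nonempty : exists t z, [/\ -1 < z < 1, off_strands t z & level t z = i].
Proof.
have k0 := kappa_gt0.
have tc : c < c + kappa / 2 < c + kappa by lra.
exists (c + kappa / 2), ((gap_floor (c + kappa / 2) + gap_ceiling (c + kappa / 2)) / 2).
have := gap_floor_lt_ceiling tc.
have := gap_floor_geN1 (c + kappa / 2); have := gap_ceiling_le1 (c + kappa / 2).
move: (gap_floor _) (gap_ceiling _) (@between_off (c + kappa / 2)) => x y B x1 y1 xy.
by have [|? ?] := B ((x + y) / 2); [lra|split=> //; lra].
Qed.

(** The pinching at c allows to bring every point of level i into the window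
    c < t < c + kappa by whole turns. *)
Lemma component_gap t z t' z' : -1 < z < 1 -> off_strands t z -> level t z = i ->
  -1 < z' < 1 -> off_strands t' z' -> level t' z' = i ->
  connected_component U (cyl t z) (cyl t' z').
Proof.
have red s y : -1 < y < 1 -> off_strands s y -> level s y = i ->
    exists2 s', c < s' < c + kappa & gap_floor s' < y < gap_ceiling s' /\ cyl s y = cyl s' y.
  move=> y1 offy lv; have [m /andP[m0 m1]] := turn_reduce kappa_gt0 (s - c).
  have [s' sE] : exists s', s' = s + m%:~R * kappa by eexists.
  have cE : cyl s' y = cyl s y by rewrite sE (cylinder_periodz turn).
  have offs : off_strands s' y.
    by apply/(off_wound_graph uniH turn H_bound); rewrite cE; apply/(off_wound_graph uniH turn H_bound).
  have lvs : level s' y = i by rewrite sE (level_periodz uniH).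
  have sc : c < s' < c + kappa.
    apply/andP; split; last lra.
    rewrite lt_neqAle; apply/andP; split; last lra.
    by apply/eqP => csE; apply: (@level_pinch y); rewrite csE.
  by exists s' => //; split=> //; exact: level_between.
move=> z1 offz lv z1' offz' lv'.
have [s sc [sb ->]] := red _ _ z1 offz lv.
have [s' sc' [sb' ->]] := red _ _ z1' offz' lv'.
exact: component_between.
Qed.

End Gap.

Lemma level_leM t z : (level t z <= M)%N.
Proof.
rewrite -[X in (_ <= X)%N]card_ord -sum1_card; apply: leq_sum => j _.
by case: (_ < _).
Qed.

Lemma level_interior t z : -1 <= z <= 1 -> off_strands t z ->
  (0 < level t z < M)%N -> -1 < z < 1.
Proof.
move=> /andP[z0 z1] _ /andP[l0 lM]; rewrite !lt_neqAle z0 z1 !andbT.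
apply/andP; split; apply/eqP => E.
  by move: lM; rewrite -E (level_south _ _ H_bound) ltnn.
by move: l0; rewrite E (level_north _ _ H_bound).
Qed.

Lemma component_levelE t z t' z' : -1 <= z <= 1 -> off_strands t z ->
  -1 <= z' <= 1 -> off_strands t' z' ->
  connected_component U (cyl t z) (cyl t' z') <-> level t' z' = level t z.
Proof.
move=> z1 offz z1' offz'; split; first exact: (component_level uniH turn H_bound).
move=> lv; have [l0|l0] := posnP (level t z).
  apply: connected_component_trans.
    exact: (component_north uniH turn H_bound).
  by apply: connected_component_sym; apply: (component_north uniH turn H_bound); rewrite ?lv.
have [lM|lM] := eqVneq (level t z) M.
  apply: connected_component_trans.
    exact: (component_south uniH turn H_bound).
  by apply: connected_component_sym; apply: (component_south uniH turn H_bound); rewrite ?lv.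
have lvi : (0 < level t z < M)%N by rewrite l0 ltn_neqAle lM level_leM.
have [c cc] := crossing_exists uniH lvi.
have zi := level_interior z1 offz lvi.
have zi' : -1 < z' < 1 by apply: (level_interior z1' offz'); rewrite lv.
exact: (component_gap lvi cc).
Qed.

Lemma level_onto n : (n <= M)%N ->
  exists t z, [/\ -1 <= z <= 1, off_strands t z & level t z = n].
Proof.
rewrite leq_eqVlt => /orP[/eqP ->|nM].
  by exists 0, (-1); split; [lra|exact: (off_south _ H_bound)|exact: (level_south _ _ H_bound)].
have [->|n0] := posnP n.
  by exists 0, 1; split; [lra|exact: (off_north _ H_bound)|exact: (level_north _ _ H_bound)].
have ni : (0 < n < M)%N by rewrite n0.
have [c cc] := crossing_exists uniH ni.
by have [t [z [z1 ? ?]]] := gap_nonempty ni cc; exists t, z; split=> //; lra.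
Qed.

Lemma card_complement_components : (connected_component U @` U) #= `I_M.+1.
Proof.
have /choice[pt ptP] : forall n, exists tz : R * R, (n <= M)%N ->
    [/\ -1 <= tz.2 <= 1, off_strands tz.1 tz.2 & level tz.1 tz.2 = n].
  move=> n; have [nM|nM] := leqP n M; last by exists (0, 0).
  by have [t [z tzP]] := level_onto nM; exists (t, z).
pose comp n := connected_component U (cyl (pt n).1 (pt n).2).
have -> : connected_component U @` U = comp @` `I_M.+1.
  apply/seteqP; split=> [_ [w Uw <-]|_ [n /= nM <-]].
    have [t [z [z1 offz ->]]] := complement_cylinder uniH turn H_bound Uw.
    have lvM := level_leM t z; have [z1' offz' lv] := ptP _ lvM.
    exists (level t z) => //; apply: same_connected_component.
    exact/component_levelE.
  have [z1 offz _] := ptP _ nM.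
  by exists (cyl (pt n).1 (pt n).2) => //; exact: (cylinder_complement uniH turn H_bound).
apply: inj_card_eq => n m; rewrite !inE /= => nM mM E.
have [z1 offz <-] := ptP _ nM; have [z1' offz' <-] := ptP _ mM.
apply/component_levelE => //; rewrite -/(comp m) -E.
by apply: connected_component_refl; exact: (cylinder_complement uniH turn H_bound).
Qed.

End Gaps.

(** * Slopes that descend in steps *)

Section Calculus.
Variable R : realType.
Implicit Types (x y u w : R) (f : R -> R).

Lemma mean_value f u w : (forall x, derivable f x 1) -> u <= w ->
  exists2 x, u <= x <= w & f w - f u = derive1 f x * (w - u).
Proof.
move=> df uw; have [||x] := @MVT_segment R f (derive1 f) u w uw.
- by move=> x _; rewrite derive1E; apply: derivableP.
- by apply: continuous_subspaceT => x; apply/differentiable_continuous/derivable1_diffP.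
by rewrite in_itv /=; exists x.
Qed.

(** By the mean value theorem the derivative takes the value m in every
    subinterval, hence, being continuous, everywhere up to the end points. *)
Lemma derive1_affine f (l r m e : R) : (forall x, derivable f x 1) ->
  continuous (derive1 f) -> l < r ->
  (forall x, l <= x <= r -> f x = e + m * x) ->
  forall x, l <= x <= r -> derive1 f x = m.
Proof.
move=> df cf lr fE x /andP[lx xr]; apply/eqP/negP => /negP ne.
have d0 : 0 < `|derive1 f x - m| by rewrite normr_gt0 subr_eq0.
have /nbhs_normP[d /= dgt dP] : \forall y \near x, derive1 f y != m.
  have := cf x => /cvgrPdist_lt /(_ _ d0); apply: filterS => y; apply: contraTneq => ->.
  by rewrite ltxx.
have [u [w [uw lu wr [ux wx]]]] : exists u w, [/\ u < w, l <= u, w <= r &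
    (`|x - u| < d) /\ (`|x - w| < d)].
  have near_d y : x - d < y < x + d -> `|x - y| < d.
    by rewrite ltr_norml => /andP[? ?]; apply/andP; split; lra.
  have [xr'|rx] := ltP x r.
    have [w [xw wr wd]] : exists w, [/\ x < w, w <= r & w < x + d].
      by have [?|?] := leP (x + d / 2) r; [exists (x + d / 2)|exists r]; split; lra.
    by exists x, w; split=> //; split; apply: near_d; lra.
  have [u [ux lu ud]] : exists u, [/\ u < x, l <= u & x - d < u].
    by have [?|?] := leP l (x - d / 2); [exists (x - d / 2)|exists l]; split; lra.
  by exists u, x; split=> //; split; apply: near_d; lra.
have [y /andP[uy yw] E] := mean_value df (ltW uw).
move: E; rewrite !fE; [|lra|lra] => E.
have wu : w - u != 0 by rewrite subr_eq0 gt_eqF.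
have yd : `|x - y| < d.
  by move: ux wx; rewrite !ltr_norml => /andP[? ?] /andP[? ?]; apply/andP; split; lra.
have /eqP : (derive1 f y - m) * (w - u) = 0 by rewrite mulrBl -E; ring.
by rewrite mulf_eq0 (negPf wu) orbF subr_eq0 (negPf (dP y yd)).
Qed.

Lemma derive1_translate f (s e : R) : (forall x, f (x + s) = f x + e) ->
  forall x, derive1 f (x + s) = derive1 f x.
Proof.
move=> fs x; rewrite /derive1; set d := (fun _ : R => _); set d' := (fun _ : R => _).
suff -> : d = d' by [].
by apply/funext => y; rewrite /d /d' addrA !fs; congr (_ *: _); ring.
Qed.

End Calculus.

Section Staircase.
Variable R : realType.
Implicit Types (x y : R) (i : nat).

(** The slope of a special front over one turn: m i along the i-th segment, and
    down across [lo i, hi i], around the i-th basepoint, for 0 < i < n.  The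
    neighbourhoods 0 and n, where the slope goes up, are end points only. *)
Record staircase (F : R -> R) (lo hi m : nat -> R) (n : nat) : Prop := {
  stair_turn : forall i, (i <= n)%N -> lo i < hi i;
  stair_gap : forall i, (i < n)%N -> hi i < lo i.+1;
  stair_flat : forall i, (i < n)%N -> forall x, hi i <= x <= lo i.+1 -> F x = m i;
  stair_drop : forall i, (0 < i < n)%N ->
    forall x y, lo i <= x -> x < y -> y <= hi i -> F y < F x
}.

Variables (F : R -> R) (lo hi m : nat -> R) (n : nat).
Hypothesis st : staircase F lo hi m n.

Lemma stair_hi_lo i j : (i < j)%N -> (j <= n)%N -> hi i < lo j.
Proof.
elim: j => // j IHj; rewrite ltnS leq_eqVlt => /orP[/eqP -> |ij] jn.
  exact: (stair_gap st).
have := IHj ij (ltnW jn) => h.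
by rewrite (lt_trans h) // (lt_trans (stair_turn st (ltnW jn))) // (stair_gap st).
Qed.

Lemma stair_dec_upto j : (j < n)%N ->
  forall x y, hi 0 <= x -> x <= y -> y <= lo j.+1 -> F y <= F x.
Proof.
elim: j => [|j IHj] jn x y hx xy yl.
  by rewrite !(stair_flat st jn) ?lexx //; apply/andP; split; lra.
have jn' := ltnW jn; have jn1 : (0 < j.+1 < n)%N by rewrite jn.
have lt1 := stair_turn st jn'; have lt2 := stair_gap st jn.
have drop u w : lo j.+1 <= u -> u <= w -> w <= hi j.+1 -> F w <= F u.
  move=> lu; rewrite le_eqVlt => /orP[/eqP -> //|uw wh].
  exact/ltW/(stair_drop st jn1).
have flat u w : hi j.+1 <= u -> u <= w -> w <= lo j.+2 -> F w <= F u.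
  by move=> hu uw wl; rewrite !(stair_flat st jn) ?lexx //; apply/andP; split; lra.
have h0 : hi 0 < lo j.+1 by apply: stair_hi_lo.
have [xl|lx] := leP x (lo j.+1); last first.
  have [xh|hx'] := leP x (hi j.+1); last by apply: flat => //; lra.
  have [yh|hy] := leP y (hi j.+1); first by apply: drop => //; lra.
  by apply: (le_trans (flat (hi j.+1) _ _ _ _)); [lra|lra|lra|apply: drop; lra].
have [yl'|ly] := leP y (lo j.+1); first exact: IHj.
have Fx : F (lo j.+1) <= F x by apply: IHj.
apply: le_trans Fx.
have [yh|hy] := leP y (hi j.+1); first by apply: drop => //; lra.
by apply: (le_trans (flat (hi j.+1) _ _ _ _)); [lra|lra|lra|apply: drop; lra].
Qed.

Lemma stair_dec x y : (0 < n)%N -> hi 0 <= x -> x <= y -> y <= lo n -> F y <= F x.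
Proof. by case: n st (@stair_dec_upto) => // n' _ D _; exact: D. Qed.

(** Between x and y the function goes down a part of the i-th step. *)
Lemma stair_strict i x y : (0 < i < n)%N -> hi 0 <= x -> x < hi i -> lo i < y ->
  x < y -> y <= lo n -> F y < F x.
Proof.
move=> i_n hx xh ly xy yl; have /andP[i0 iltn] := i_n.
have n0 := ltn_trans i0 iltn.
have h1 := stair_hi_lo i0 (ltnW iltn); have h2 := stair_hi_lo iltn (leqnn n).
have lh := stair_turn st (ltnW iltn).
have [x' [xx' [lx' x'E]]] : exists x', x <= x' /\ lo i <= x' /\ (x' = x \/ x' = lo i).
  by have [?|?] := leP x (lo i); [exists (lo i)|exists x];
    split; [lra|split; [lra|tauto]|lra|split; [lra|tauto]].
have [y' [yy' [ly' y'E]]] : exists y', y' <= y /\ y' <= hi i /\ (y' = y \/ y' = hi i).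
  by have [?|?] := leP y (hi i); [exists y|exists (hi i)];
    split; [lra|split; [lra|tauto]|lra|split; [lra|tauto]].
have xy' : x' < y' by case: x'E y'E => -> [] ->; lra.
apply: (@le_lt_trans _ _ (F y')); first by apply: stair_dec => //; lra.
apply: (@lt_le_trans _ _ (F x')); first exact: (stair_drop st i_n).
by apply: stair_dec => //; lra.
Qed.

Lemma stair_locate x : hi 0 <= x -> x <= lo n ->
  exists2 i, (i < n)%N & hi i <= x < hi i.+1.
Proof.
move=> hx xl; have xh : x < hi n by apply: (le_lt_trans xl); exact: (stair_turn st).
move: xh; clear xl; elim: {-2}n (leqnn n) => [|j IHj] jn xh; first lra.
have [xj|jx] := ltP x (hi j); last by exists j => //; rewrite jx.
by have [i ij ix] := IHj (ltnW jn) xj; exists i => //; exact: ltnW.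
Qed.

End Staircase.

(** * Special fronts *)

Section ExpandingInverse.
Variable R : realType.
Implicit Types (x y s t : R).

(** The inverse is continuous because it is 1-Lipschitz. *)
Lemma expanding_inverse (g : R -> R) : continuous g ->
  (forall x y, x < y -> y - x <= g y - g x) ->
  exists X : R -> R, [/\ forall t, g (X t) = t, forall x, X (g x) = x,
    continuous X & forall s t, (s < t) = (X s < X t)].
Proof.
move=> cg exp.
have mono x y : (x < y) = (g x < g y).
  apply/idP/idP => [xy|gxy]; first by have := exp _ _ xy; lra.
  have [//|lt|E] := ltgtP x y; first by have := exp _ _ lt; lra.
  by move: gxy; rewrite E ltxx.
have ginj : injective g.
  by move=> x y E; have [lt|lt|//] := ltgtP x y; move: lt; rewrite mono E ltxx.
have /choice[X gX] : forall t, exists x, g x = t.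
  move=> t; pose d := `|t - g 0|; have d0 : 0 <= d by exact: normr_ge0.
  have [dt td] : t - g 0 <= d /\ - d <= t - g 0.
    by split; [exact: ler_norm|rewrite lerNl /d -normrN ler_norm].
  have glo : g (- d) <= t.
    move: d0; rewrite le_eqVlt => /orP[/eqP d0|d0]; first by move: dt; rewrite -d0 oppr0; lra.
    by have := @exp (- d) 0; rewrite oppr_lt0 d0 => /(_ isT); lra.
  have ghi : t <= g d.
    move: d0; rewrite le_eqVlt => /orP[/eqP d0|d0]; first by move: dt; rewrite -d0; lra.
    by have := @exp 0 d d0; lra.
  have gle : g (- d) <= g d by lra.
  have [|||x _ gx] := @IVT R g (- d) d t; [lra|exact: continuous_subspaceT| |by exists x].
  by rewrite ge_min le_max glo ghi orbT.
have Xg x : X (g x) = x by apply: ginj; rewrite gX.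
have Xmono s t : (s < t) = (X s < X t) by rewrite [RHS]mono !gX.
exists X; split=> // t; apply/cvgrPdist_lt => e e0.
apply/nbhs_normP; exists e => //= s /= tse.
have [lt|lt|->] := ltgtP (X t) (X s); last by rewrite subrr normr0.
  move: tse; have := exp _ _ lt; rewrite !gX => h.
  by rewrite !ltr_norml => /andP[? ?]; apply/andP; split; lra.
move: tse; have := exp _ _ lt; rewrite !gX => h.
by rewrite !ltr_norml => /andP[? ?]; apply/andP; split; lra.
Qed.

End ExpandingInverse.

Section Front.
Variable R : realType.
Implicit Types (x y s t : R) (i : nat).

(** th1 - th2, constant on Reeb orbits; the azimuth is p/k times it. *)
Definition orbit_angle (f : R -> R) x : R := x - f x.

(** fp_wide and fp_shallow express that the perturbation is small: a point that
    is h - 1 boxes to the right of the first neighbourhood is still on the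
    horizontal part, and the steepest horizontal segment, prolonged over h - 1
    boxes, descends by less than a box. *)
Record front_profile (f : R -> R) (beta : R) (h v : nat) (lo hi m : nat -> R) : Prop := {
  fp_derivable : forall x, derivable f x 1;
  fp_cont : continuous (derive1 f);
  fp_turn : forall x, f (x + h%:R * beta) = f x - v%:R * beta;
  fp_stair : staircase (derive1 f) lo hi m (h + v);
  fp_rise : forall x y, lo 0 <= x -> x < y -> y <= hi 0 -> derive1 f x < derive1 f y;
  fp_close : lo (h + v)%N = lo 0 + h%:R * beta;
  fp_neg : forall x, derive1 f x < 0;
  fp_angle_hi : forall i, (i < h + v)%N -> i%:R * beta < orbit_angle f (hi i);
  fp_angle_lo : forall i, (i < h + v)%N -> orbit_angle f (lo i.+1) < i.+1%:R * beta;
  fp_wide : hi 0 + h.-1%:R * beta <= lo h;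
  fp_shallow : - beta < m h.-1 * (h.-1%:R * beta)
}.

(** Basepoint i is at angle i beta, and the curve leaves and enters its
    neighbourhood along lines through it of negative slope, on which the angle
    increases.  A horizontal segment has slope at least about - 2 eps / beta,
    which is above - 1 / h for eps = beta / (8 h). *)
Lemma special_front_profile (p h v : nat) (eps : R) f :
  (0 < p)%N -> (0 < h)%N -> (0 < v)%N -> eps = box R p / (8 * h%:R) ->
  special_front p h v eps f ->
  exists lo hi m, front_profile f (box R p) h v lo hi m.
Proof.
move=> p0 h0 v0 epsE [d [lo [hi [[dn deps] [mneg mdec] [lon hin bnd gap] [smf ftr flat mono]]]]].
set beta := box R p in epsE lon hin ftr *.
have beta0 : 0 < beta by rewrite /beta /box divr_gt0 ?mulr_gt0 ?pi_gt0 ?ltr0n.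
pose n := (h + v)%N; pose P := basepoint p h d; pose m i := slope (P i) (P i.+1).
have {}mneg i : (i < n)%N -> m i < 0 by exact: mneg.
have {}mdec i j : (i < j)%N -> (j < n)%N -> m j < m i by exact: mdec.
exists lo, hi, m.
have hR : 1 <= h%:R :> R by rewrite ler1n.
have eps_h : 8 * (h%:R * eps) = beta by rewrite epsE; field; lra.
have eps0 : 0 < eps by rewrite epsE divr_gt0 // mulr_gt0 //; lra.
have eps_beta : 8 * eps <= beta.
  by rewrite -eps_h ler_pM2l // ler_peMl // ltW.
have derf x : derivable f x 1 by exact: (smf 0%N x).
have cF : continuous (derive1 f).
  by move=> x; apply/differentiable_continuous/derivable1_diffP; exact: (smf 1%N x).
have P1lo i : (i <= n)%N -> lo i < (P i).1 by move=> /bnd[/andP[]].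
have P1hi i : (i <= n)%N -> (P i).1 < hi i by move=> /bnd[_ /andP[]].
have turn i : (i <= n)%N -> lo i < hi i.
  by move=> i_n; exact: lt_trans (P1lo _ i_n) (P1hi _ i_n).
have Plt i : (i < n)%N -> (P i).1 < (P i.+1).1.
  by move=> i_n; have := P1hi _ (ltnW i_n); have := P1lo _ i_n; have := gap _ i_n; lra.
have slopeE i : (i < n)%N -> (P i.+1).2 = (P i).2 + m i * ((P i.+1).1 - (P i).1).
  by move=> i_n; have := Plt _ i_n; rewrite /m /slope => lt; rewrite divfK; lra.
have Pangle i : (P i).1 - (P i).2 = i%:R * beta.
  rewrite /P /basepoint /= -/beta.
  have -> : i%:R = (minn i h)%:R + (i - h)%:R :> R by rewrite -natrD; congr _%:R; lia.
  ring.
have Fflat i : (i < n)%N -> forall x, hi i <= x <= lo i.+1 -> derive1 f x = m i.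
  move=> i_n; apply: (@derive1_affine _ _ _ _ _ ((P i).2 - m i * (P i).1)) => //.
    exact: gap.
  by move=> x xi; rewrite (flat i i_n x xi) -/P -/(m i); ring.
have n0 : (0 < n)%N by rewrite addn_gt0 h0.
have Fhi i : (i < n)%N -> derive1 f (hi i) = m i.
  by move=> i_n; apply: (Fflat i i_n); rewrite lexx ltW // gap.
have Flo i : (i < n)%N -> derive1 f (lo i.+1) = m i.
  by move=> i_n; apply: (Fflat i i_n); rewrite lexx ltW // gap.
have st : staircase (derive1 f) lo hi m n.
  split=> // i /andP[i0 i_n].
  have [inc|dec //] := mono i (ltnW i_n).
  have := inc (lo i) (hi i) (lexx _) (turn _ (ltnW i_n)) (lexx _).
  have i1 : (i.-1 < n)%N by lia.
  have := Flo _ i1; rewrite prednK // => ->; rewrite (Fhi _ i_n).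
  by have := mdec i.-1 i; rewrite prednK // => /(_ (leqnn _) i_n) ?; lra.
have Ftr x : derive1 f (x + h%:R * beta) = derive1 f x.
  by apply: (derive1_translate (e := - (v%:R * beta))).
have Flo0 : derive1 f (lo 0) = m n.-1.
  rewrite -Ftr -lon; have n1 : (n.-1 < n)%N by rewrite prednK.
  by rewrite -(Flo _ n1) prednK.
have rise x y : lo 0 <= x -> x < y -> y <= hi 0 -> derive1 f x < derive1 f y.
  have [inc|dec] := mono 0%N (leq0n _); first exact: inc.
  have := dec (lo 0) (hi 0) (lexx _) (turn _ (leq0n _)) (lexx _).
  rewrite Flo0 (Fhi _ n0); have n1 : (0 < n.-1)%N by lia.
  by have := mdec 0%N n.-1 n1; rewrite prednK // => /(_ (leqnn _)); lra.
have neg x : derive1 f x < 0.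
  have hb0 : 0 < h%:R * beta by rewrite mulr_gt0 //; lra.
  have [j /andP[j0 j1]] := turn_reduce hb0 (x - lo 0).
  have [y yE] : exists y, y = x + j%:~R * (h%:R * beta) by eexists.
  rewrite -(periodic_intr Ftr j x) -yE.
  have y0 : lo 0 <= y by lra.
  have y1 : y <= lo n by rewrite lon; lra.
  have m0 : derive1 f (hi 0) < 0 by rewrite Fhi //; exact: mneg.
  apply: le_lt_trans m0; have [yh|hy] := leP (hi 0) y.
    exact: (stair_dec st).
  exact/ltW/rise.
have dP i : (i <= n)%N -> - eps < d i < eps by move=> /deps; rewrite ltr_norml.
have P0 : (P 0%N).1 = beta / 2 + d 0%N by rewrite /P /basepoint /= -/beta min0n; lra.
have Ph i : (i <= h)%N -> P i = (beta * (i%:R + 2^-1) + d i, beta / 2 + d i).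
  move=> ih; rewrite /P /basepoint -/beta (minn_idPl ih).
  have -> : (i - h = 0)%N by lia.
  by congr (_, _); ring.
have hE : h%:R = h.-1%:R + 1 :> R by rewrite natr1 prednK.
have dh := dP h (leq_addr _ _); have dh1 : - eps < d h.-1 < eps by apply: dP; lia.
have d0 := dP 0%N (leq0n _).
split=> //.
- move=> i i_n; have := P1hi _ (ltnW i_n); rewrite -Pangle /orbit_angle.
  rewrite (flat i i_n) ?lexx ?ltW ?gap // -/P -/(m i) => h1.
  have := mulr_gt0 (_ : 0 < hi i - (P i).1) (_ : 0 < 1 - m i).
  by have := mneg _ i_n => h2 h3; have := h3 ltac:(lra) ltac:(lra); lra.
- move=> i i_n; have := P1lo _ i_n; rewrite -Pangle /orbit_angle.
  rewrite (flat i i_n) ?lexx ?ltW ?gap // -/P -/(m i) (slopeE _ i_n) => h1.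
  have := mulr_gt0 (_ : 0 < (P i.+1).1 - lo i.+1) (_ : 0 < 1 - m i).
  by have := mneg _ i_n => h2 h3; have := h3 ltac:(lra) ltac:(lra); lra.
- have [_ /andP[_]] := bnd 0%N (leq0n _); have [/andP[+ _] _] := bnd h (leq_addr _ _).
  by rewrite -/P P0 Ph //= hE; lra.
- have h1n : (h.-1 < n)%N by rewrite prednK // leq_addr.
  have := slopeE _ h1n; have := Plt _ h1n; have := mneg _ h1n.
  rewrite prednK // !Ph ?leqnn ?leq_pred //= hE.
  move: (m h.-1) dh dh1 => mm /andP[? ?] /andP[? ?] mm0 pos E.
  have hm : 0 <= h.-1%:R :> R by [].
  (* The width of the last horizontal segment, a box up to 2 eps. *)
  set W := _ - _ in pos E.
  have W34 : 3 / 4 * beta <= W by rewrite /W; lra.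
  have mW : mm * W <= mm * (3 / 4 * beta) by rewrite ler_nM2l.
  have mb : - (8 / 3) * eps <= mm * beta by lra.
  have := ler_wpM2r hm mb; rewrite hE in eps_h; lra.
Qed.

End Front.

(** * The height along a special front is unimodal *)

Section FrontToProfile.
Variable R : realType.
Implicit Types (x y s t : R).

(** The height 1 - 2 r1^2 at slope m = - r1^2 / (1 - r1^2). *)
Definition slope_height (m : R) : R := (1 + m) / (1 - m).

Lemma slope_height_lt (m m' : R) : m < 1 -> m' < 1 ->
  (slope_height m < slope_height m') = (m < m').
Proof.
move=> m1 m1'.
have d1 : 0 < 1 - m by lra.
have d2 : 0 < 1 - m' by lra.
rewrite /slope_height ltr_pdivrMr // mulrAC ltr_pdivlMr //.
apply/idP/idP => h; lra.
Qed.

Lemma slope_height_inj (m m' : R) : m < 1 -> m' < 1 ->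
  slope_height m = slope_height m' -> m = m'.
Proof.
move=> m1 m1' E; have [lt|lt|//] := ltgtP m m'.
  by move: lt; rewrite -slope_height_lt // E ltxx.
by move: lt; rewrite -slope_height_lt // E ltxx.
Qed.

Lemma slope_height_bound (m : R) : m < 0 -> -1 < slope_height m < 1.
Proof.
move=> m0; have d1 : 0 < 1 - m by lra.
by rewrite /slope_height ltr_pdivlMr // ltr_pdivrMr //; apply/andP; split; lra.
Qed.

Variables (f : R -> R) (beta : R) (h v : nat) (lo hi m : nat -> R).
Hypothesis fp : front_profile f beta h v lo hi m.
Hypothesis beta_gt0 : 0 < beta.
Hypothesis h_gt0 : (0 < h)%N.

Local Notation F := (derive1 f).
Local Notation n := (h + v)%N.
Local Notation tau := (orbit_angle f).

Lemma front_decreasing x y : x < y -> f y < f x.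
Proof.
move=> xy; have [z _ E] := mean_value (fp_derivable fp) (ltW xy).
rewrite -subr_lt0 E nmulr_rlt0 ?(fp_neg fp) // subr_gt0 //.
Qed.

Lemma orbit_angle_turn x : tau (x + h%:R * beta) = tau x + n%:R * beta.
Proof. by rewrite /orbit_angle (fp_turn fp) natrD; ring. Qed.

Lemma slope_turn x : F (x + h%:R * beta) = F x.
Proof. by apply: (derive1_translate (e := - (v%:R * beta))); exact: (fp_turn fp). Qed.

Lemma front_inverse : exists X : R -> R, [/\ forall t, tau (X t) = t,
    forall x, X (tau x) = x, continuous X & forall s t, (s < t) = (X s < X t)].
Proof.
apply: expanding_inverse => [x|x y xy].
  apply: cvgB; first exact: cvg_id.
  by apply/differentiable_continuous/derivable1_diffP/(fp_derivable fp).
by rewrite /orbit_angle; have := front_decreasing xy; lra.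
Qed.

Section Inverse.
Variable X : R -> R.
Hypotheses (tauX : forall t, tau (X t) = t) (Xtau : forall x, X (tau x) = x).
Hypotheses (cX : continuous X) (Xmono : forall s t, (s < t) = (X s < X t)).

Lemma front_inverse_turn t : X (t + n%:R * beta) = X t + h%:R * beta.
Proof. by rewrite -[in LHS](tauX t) -orbit_angle_turn Xtau. Qed.

Lemma front_inverse_le s t : (s <= t) = (X s <= X t).
Proof. by rewrite !leNgt Xmono. Qed.

Definition front_height t := slope_height (F (X t)).

Lemma front_height_lt s t : (front_height s < front_height t) = (F (X s) < F (X t)).
Proof. by apply: slope_height_lt; apply: lt_trans (fp_neg fp _) _; exact: ltr01. Qed.

Lemma front_height_bound t : -1 < front_height t < 1.
Proof. exact/slope_height_bound/(fp_neg fp). Qed.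

Lemma front_height_continuous : continuous front_height.
Proof.
have cF : continuous (F \o X).
  by move=> t; apply: continuous_comp; [exact: cX|exact: (fp_cont fp)].
move=> t; apply: cvgM; first by apply: cvgD; [exact: cvg_cst|exact: cF].
apply: cvgV; first by have := fp_neg fp (X t); lra.
by apply: cvgB; [exact: cvg_cst|exact: cF].
Qed.

(** The delicate point is uni_drop.  If s is past step i but not past step i + 1,
    its angle is more than i beta; so at angle s + beta and later the front is
    past the beginning of step i + 1, where the slope goes down. *)
Lemma front_unimodal (k M : nat) : (k * M = n)%N ->
  unimodal front_height (k%:R * beta) (n%:R * beta) M (tau (lo 0)) (tau (hi 0)).
Proof.
move=> kM; have b0 := beta_gt0.
have n0 : (0 < n)%N by rewrite addn_gt0 h_gt0.
have /andP[k0 M0] : (0 < k)%N && (0 < M)%N by rewrite -muln_gt0 kM.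
have k1 : 1 <= k%:R :> R by rewrite ler1n.
have loT : tau (lo 0) + n%:R * beta = tau (lo n) by rewrite (fp_close fp) orbit_angle_turn.
have st := fp_stair fp.
have dec s t : tau (hi 0) <= s -> s <= t -> t <= tau (lo n) -> F (X t) <= F (X s).
  rewrite front_inverse_le Xtau => hs; rewrite front_inverse_le => st'.
  by rewrite front_inverse_le Xtau => tl; exact: (stair_dec st).
split=> //.
- by rewrite -kM natrM; ring.
- by rewrite mulr_gt0 //; lra.
- by rewrite Xmono !Xtau (stair_turn st).
- by rewrite loT Xmono !Xtau (stair_hi_lo st).
- exact: front_height_continuous.
- by move=> t; rewrite /front_height front_inverse_turn slope_turn.
- move=> s t; rewrite front_inverse_le Xtau => ls; rewrite Xmono => st'.
  by rewrite front_inverse_le Xtau front_height_lt; exact: (fp_rise fp).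
- move=> s t hs st'; rewrite loT => tl.
  by rewrite leNgt front_height_lt -leNgt dec.
move=> s t hs skt; rewrite loT => tl; rewrite front_height_lt.
have st1 : s + beta <= t.
  by apply: le_trans skt; rewrite lerD2l ler_peMl // ltW.
have sX : hi 0 <= X s by rewrite -(Xtau (hi 0)) -front_inverse_le.
have tX : X t <= lo n by rewrite -(Xtau (lo n)) -front_inverse_le.
have stX : X s < X t by rewrite -Xmono; lra.
have sl : X s <= lo n by lra.
have [i i_n /andP[is1 is2]] := stair_locate st sX sl.
have t_lo : lo i.+1 < X t.
  rewrite -(Xtau (lo i.+1)) -Xmono.
  have := fp_angle_lo fp i_n; have := fp_angle_hi fp i_n.
  have : tau (hi i) <= s by rewrite front_inverse_le Xtau.
  by rewrite -natr1 mulrDl; lra.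
have [i_n'|n_i] := ltnP i.+1 n; first by apply: (stair_strict st (i := i.+1)).
have iE : i.+1 = n by apply/eqP; rewrite eqn_leq i_n.
by move: t_lo; rewrite iE; lra.
Qed.

End Inverse.

(** Points of the front whose lifts differ by whole boxes, as two lifts of the
    same point of L(p,q) do, are never the two branches of a crossing.  Since y
    is less than a turn away, it would be at most h - 1 boxes to the right of x,
    hence on the horizontal part, and at least one box below.  From x to y the
    slope is at least its value at y, because x is on the rise and y on the
    descent; the front is then too flat to descend by a box. *)
Lemma front_no_lattice_chord x y (A B : int) :
  lo 0 <= x <= hi 0 -> hi 0 <= y <= lo n -> x < y -> y < x + h%:R * beta ->
  F x = F y -> y = x + A%:~R * beta -> f y = f x + B%:~R * beta -> False.
Proof.
move=> /andP[lx xh] /andP[hy yl] xy yx Fxy yA fB.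
have b0 := beta_gt0; have st := fp_stair fp.
have n0 : (0 < n)%N by rewrite addn_gt0 h_gt0.
have Ah : (A <= h.-1%:Z)%R.
  have : (A%:~R < h%:Z%:~R :> R) by rewrite -(ltr_pM2r b0); move: yx; rewrite yA ltrD2l.
  by rewrite ltr_int; have := h_gt0; lia.
have B1 : (B <= -1)%R.
  have : (B%:~R < 0%:~R :> R).
    by rewrite -(ltr_pM2r b0) mul0r; have := front_decreasing xy; rewrite fB; lra.
  by rewrite ltr_int; lia.
have Ab : y - x <= h.-1%:R * beta.
  have : (A%:~R * beta <= h.-1%:Z%:~R * beta) by rewrite ler_pM2r // ler_int.
  by rewrite yA -[h.-1%:Z%:~R]/(h.-1%:R); lra.
have Bb : f y - f x <= - beta.
  have : (B%:~R * beta <= (-1)%:~R * beta) by rewrite ler_pM2r // ler_int.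
  by rewrite fB mulrNz; lra.
have hn : (h.-1 < n)%N by rewrite prednK // leq_addr.
have ylh : y <= lo h by have := fp_wide fp; lra.
have Flo : F (lo h) = m h.-1.
  by rewrite -(prednK h_gt0); apply: (stair_flat st hn); rewrite lexx ltW // (stair_gap st).
have lohn : lo h <= lo n.
  have [->|v0] := posnP v; first by rewrite addn0.
  have hh : (h < n)%N by rewrite -[X in (X < _)%N]addn0 ltn_add2l.
  by rewrite ltW // (lt_trans (stair_turn st (ltnW hh))) // (stair_hi_lo st).
have mF : m h.-1 <= F y by rewrite -Flo; apply: (stair_dec st).
have [z /andP[xz zy] E] := mean_value (fp_derivable fp) (ltW xy).
have Fz : F y <= F z.
  have [hz|zh] := leP (hi 0) z; first exact: (stair_dec st).
  rewrite -Fxy; move: xz; rewrite le_eqVlt => /orP[/eqP -> //|xz].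
  by rewrite ltW // (fp_rise fp) // ltW.
have m0 : m h.-1 < 0 by rewrite -Flo (fp_neg fp).
have xy0 : 0 <= y - x by lra.
have e1 : m h.-1 * (y - x) <= F z * (y - x) by rewrite ler_wpM2r //; lra.
have e2 : m h.-1 * (h.-1%:R * beta) <= m h.-1 * (y - x) by rewrite ler_nM2l.
have := fp_shallow fp; lra.
Qed.

End FrontToProfile.

(** * The Legendrian knot of a front *)

Section KnotInLens.
Variable R : realType.
Implicit Types (x y s t : R).
Local Notation C := (complex R).

Lemma cis_conj t : conjc (cis t) = cis (- t) :> C.
Proof. by rewrite /cis cosN sinN. Qed.

Lemma cis_inj s t : cis s = cis t :> C -> exists m : int, t = s + m%:~R * (pi *+ 2).
Proof. by case=> c d; exact: cos_sin_inj. Qed.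

Lemma normc_real (r : R) : normc (r%:C)%C = `|r|.
Proof. by rewrite /= expr0n addr0 sqrtr_sqr. Qed.

Lemma lagr_polar (p q : nat) (r1 r2 a b : R) : 0 < r1 -> 0 < r2 ->
  lagr p q ((r1%:C)%C * cis a, (r2%:C)%C * cis b) =
  (2 * (r1 * r2) * cos ((a - b) *+ (p %/ gcdn (q - 1) p)),
   2 * (r1 * r2) * sin ((a - b) *+ (p %/ gcdn (q - 1) p)), r2 ^+ 2 - r1 ^+ 2).
Proof.
move=> r10 r20.
set z1 := _ * cis a; set z2 := _ * cis b.
have z1E : z1 = (r1%:C)%C * cis a by [].
have z2E : z2 = (r2%:C)%C * cis b by [].
clearbody z1 z2; rewrite /lagr /=.
have nrm r t : 0 < r -> normc ((r%:C)%C * cis t) = r.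
  by move=> r0; rewrite normcM normc_real normc_cis mulr1 gtr0_norm.
have uE : z1 * conjc z2 = ((r1 * r2)%:C)%C * cis (a - b).
  rewrite z1E z2E; have -> : conjc ((r2%:C)%C * cis b) = (r2%:C)%C * cis (- b).
    by rewrite -cis_conj rmorphM /= oppr0.
  by rewrite mulrACA -cisD -rmorphM.
rewrite uE z1E z2E !nrm ?mulr_gt0 //.
have -> : ((r1 * r2)%:C)%C * cis (a - b) / ((r1 * r2)%:C)%C = cis (a - b).
  by rewrite mulrAC divff ?mul1r //; apply/eqP => -[/eqP]; rewrite mulf_eq0 !gt_eqF.
by rewrite cisX.
Qed.

Variables (p q : nat) (f : R -> R).
Hypothesis p_gt0 : (0 < p)%N.
Hypothesis q_gt0 : (0 < q)%N.
Hypothesis f_neg : forall x, derive1 f x < 0.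
Local Notation F := (derive1 f).
Local Notation beta := (box R p).

(** The solution r1 of f' = - r1^2 / (1 - r1^2). *)
Definition front_radius x : R := Num.sqrt (- F x / (1 - F x)).

Lemma sqr_front_radius x : front_radius x ^+ 2 = - F x / (1 - F x).
Proof.
by have := f_neg x => F0; rewrite sqr_sqrtr // divr_ge0 //; lra.
Qed.

Lemma front_radius_bound x : 0 < front_radius x < 1.
Proof.
have F0 := f_neg x; rewrite sqrtr_gt0 divr_gt0; [|lra|lra].
by rewrite -(@expr_lt1 _ 2) ?sqrtr_ge0 // sqr_front_radius ltr_pdivrMr; lra.
Qed.

Lemma front_radius_uniq x (r : R) : 0 < r < 1 ->
  F x = - r ^+ 2 / (1 - r ^+ 2) -> r = front_radius x.
Proof.
move=> /andP[r0 r1] FE.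
have r21 : r ^+ 2 < 1 by rewrite expr_lt1 // ltW.
rewrite /front_radius FE.
have -> : - (- r ^+ 2 / (1 - r ^+ 2)) / (1 - - r ^+ 2 / (1 - r ^+ 2)) = r ^+ 2.
  by field; lra.
by rewrite sqrtr_sqr gtr0_norm.
Qed.

Definition knot_lift x : C * C :=
  (((front_radius x)%:C)%C * cis x,
   ((Num.sqrt (1 - front_radius x ^+ 2))%:C)%C * cis (f x)).

Lemma knot_lift_S3 x : is_S3 (knot_lift x).
Proof.
have /andP[r0 r1] := front_radius_bound x.
have r21 : front_radius x ^+ 2 < 1 by rewrite expr_lt1 // ltW.
change (normc (((front_radius x)%:C)%C * cis x) ^+ 2 +
  normc (((Num.sqrt (1 - front_radius x ^+ 2))%:C)%C * cis (f x)) ^+ 2 == 1).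
rewrite !normcM !normc_real !normc_cis !mulr1 !real_normK ?num_real //.
by rewrite [X in _ + X]sqr_sqrtr ?subr_ge0 ?(ltW r21) // addrC subrK.
Qed.

Definition knot x : lens R p q := lens_pi p q (exist _ (knot_lift x) (knot_lift_S3 x)).

Lemma legendrian_of_frontE : @legendrian_of_front R p q f = range knot.
Proof.
apply/seteqP; split=> [w [x [r [rb FE [z zE ->]]]]|_ [x _ <-]].
  exists x => //; rewrite /knot; congr lens_pi; apply: val_inj => /=.
  by rewrite zE /knot_lift -(front_radius_uniq rb FE).
exists x, (front_radius x); split.
- exact: front_radius_bound.
- rewrite sqr_front_radius; have := f_neg x => F0; field; lra.
- by exists (exist _ (knot_lift x) (knot_lift_S3 x)).
Qed.

Lemma knot_proj x : lagrangian_proj (knot x) =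
  cylinder (p %/ gcdn (q - 1) p)%:R (orbit_angle f x) (slope_height (F x)).
Proof.
have /andP[r0 r1] := front_radius_bound x; have F0 := f_neg x.
have r21 : front_radius x ^+ 2 < 1 by rewrite expr_lt1 // ltW.
rewrite lagrangian_proj_pi //= /knot_lift lagr_polar // ?sqrtr_gt0 ?subr_gt0 //.
have sE : Num.sqrt (1 - front_radius x ^+ 2) ^+ 2 = 1 - front_radius x ^+ 2.
  by apply: sqr_sqrtr; rewrite subr_ge0 ltW.
rewrite sE.
have zE : 1 - front_radius x ^+ 2 - front_radius x ^+ 2 = slope_height (F x).
  by rewrite sqr_front_radius /slope_height; field; lra.
rewrite zE /cylinder -zE -/(orbit_angle f x) -(mulr_natl (orbit_angle f x)).
suff -> : Num.sqrt (1 - (1 - front_radius x ^+ 2 - front_radius x ^+ 2) ^+ 2) =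
    2 * (front_radius x * Num.sqrt (1 - front_radius x ^+ 2)) by [].
have -> : 1 - (1 - front_radius x ^+ 2 - front_radius x ^+ 2) ^+ 2 =
    (2 * front_radius x) ^+ 2 * (1 - front_radius x ^+ 2) by ring.
by rewrite sqrtrM ?sqr_ge0 // sqrtr_sqr gtr0_norm ?mulr_gt0 // mulrA.
Qed.

(** The lifts of a point of the Heegaard torus differ by integral combinations
    of (p box, 0) and (q box, box). *)
Lemma knot_eq x y : knot x = knot y ->
  exists A B : int, y = x + A%:~R * beta /\ f y = f x + B%:~R * beta.
Proof.
have pN0 : p%:R != 0 :> R by rewrite pnatr_eq0 -lt0n.
have /andP[rx0 rx1] := front_radius_bound x; have /andP[ry0 ry1] := front_radius_bound y.
have rx21 : front_radius x ^+ 2 < 1 by rewrite expr_lt1 // ltW.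
move=> /eqP; rewrite /knot /lens_pi eqmodE => /asboolP[n] /(congr1 val).
rewrite val_iterFpq !cisX => E.
have e1 : ((front_radius y)%:C)%C * cis y = cis (2 * pi * q%:R / p%:R *+ n) *
    (((front_radius x)%:C)%C * cis x) := congr1 fst E.
have e2 : ((Num.sqrt (1 - front_radius y ^+ 2))%:C)%C * cis (f y) = cis (2 * pi / p%:R *+ n) *
    (((Num.sqrt (1 - front_radius x ^+ 2))%:C)%C * cis (f x)) := congr1 snd E.
clear E.
have rE : front_radius y = front_radius x.
  move/(congr1 (@normc R)): e1.
  by rewrite !normcM !normc_cis !normc_real (gtr0_norm rx0) (gtr0_norm ry0) !mulr1 mul1r.
have cancel (r s t a : R) : r != 0 ->
    (r%:C)%C * cis s = cis a * ((r%:C)%C * cis t) -> cis s = cis (t + a) :> C.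
  move=> r0; rewrite mulrCA -cisD [a + t]addrC; apply: mulfI.
  by apply/eqP => -[/eqP]; rewrite (negPf r0).
rewrite rE in e1 e2.
have [m1 y1] := cis_inj (esym (cancel _ _ _ _ (lt0r_neq0 rx0) e1)).
have s0 : Num.sqrt (1 - front_radius x ^+ 2) != 0 by rewrite gt_eqF // sqrtr_gt0 subr_gt0.
have [m2 y2] := cis_inj (esym (cancel _ _ _ _ s0 e2)).
exists (q%:Z * n%:Z + m1 * p%:Z), (n%:Z + m2 * p%:Z).
rewrite y2 y1 !intrD !intrM /box.
have nE (a : R) k : a *+ k = a * k%:R by rewrite mulr_natr.
have zE (k : nat) : k%:Z%:~R = k%:R :> R by [].
rewrite (nE pi) (nE (2 * pi / p%:R)) (nE (2 * pi * q%:R / p%:R)) !zE.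
by split; field.
Qed.

(** As h = - v q modulo p, the translation by (h box, - v box) is, up to full
    turns, the (p - v)-th power of the generator of the group. *)
Lemma knot_turn (h v : nat) : (v < p)%N -> (p %| h + v * q)%N ->
  (forall x, f (x + h%:R * beta) = f x - v%:R * beta) ->
  forall x, knot (x + h%:R * beta) = knot x.
Proof.
move=> v_p /dvdnP[c hvq] ftr x.
have pN0 : p%:R != 0 :> R by rewrite pnatr_eq0 -lt0n.
have Ftr : F (x + h%:R * beta) = F x.
  by apply: (derive1_translate (e := - (v%:R * beta))).
have rE : front_radius (x + h%:R * beta) = front_radius x by rewrite /front_radius Ftr.
apply/esym/eqP; rewrite /knot /lens_pi eqmodE; apply/asboolP; exists (p - v)%N.
apply: val_inj; rewrite val_iterFpq !cisX.
rewrite -[LHS]/(knot_lift _) -[val _]/(knot_lift x) /knot_lift rE ftr.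
have turns (s t : R) (m1 m2 : nat) : s + pi *+ 2 *+ m1 = t + pi *+ 2 *+ m2 ->
    cis s = cis t :> C.
  move=> E; rewrite -[LHS]mulr1 -(cis_turns R m1) -cisD E cisD cis_turns mulr1 //.
have nE (a : R) k : a *+ k = a * k%:R by rewrite mulr_natr.
have hvq' : h%:R = c%:R * p%:R - v%:R * q%:R :> R.
  by rewrite -!natrM -hvq natrD; ring.
congr (_, _).
  rewrite [RHS]mulrCA -cisD; congr (_ * _).
  apply: (turns _ _ q c); rewrite (nE pi) (nE (pi * _)) (nE (pi * 2)) (nE (_ / _)).
  rewrite natrB ?(ltnW v_p) // hvq' /box.
  by field.
rewrite [RHS]mulrCA -cisD; congr (_ * _).
apply: (turns _ _ 1%N 0%N); rewrite mulr1n mulr0n addr0 (nE pi) (nE (_ / _)).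
rewrite natrB ?(ltnW v_p) // /box.
by field.
Qed.

End KnotInLens.

(** * Crossings and regions of the Lagrangian projection *)

Section CrossingPoints.
Variable R : realType.
Variables (H : R -> R) (kappa T : R) (M : nat) (a b omega : R).
Hypothesis uniH : unimodal H kappa T M a b.
Hypothesis turn : omega * kappa = pi *+ 2.
Hypothesis H_bound : forall t, -1 < H t < 1.

Definition crossing_points : set (R * R * R) :=
  [set w | exists i c, [/\ (0 < i < M)%N, crossing_at H kappa T a b i c &
    w = cylinder omega c (H c)]].

Lemma card_crossing_points :
  crossing_points #= [set i : nat | (0 < i < M)%N].
Proof.
have /choice[c cP] : forall i, exists c, (0 < i < M)%N -> crossing_at H kappa T a b i c.
  move=> i; case: (boolP (0 < i < M)%N) => [iM|_]; last by exists 0.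
  by have [c cc] := crossing_exists uniH iM; exists c.
have -> : crossing_points =
    (fun i => cylinder omega (c i) (H (c i))) @` [set i : nat | (0 < i < M)%N].
  apply/seteqP; split=> [w [i [d [iM dP ->]]]|_ [i iM <-]].
    by exists i => //=; rewrite (crossing_at_uniq uniH dP (cP i iM)).
  by exists i, (c i); split=> //; exact: cP.
apply: inj_card_eq => i j; rewrite !inE => iM jM E.
have [HE _] := cylinder_inj turn (H_bound _) E.
by have [] := crossing_level_inj uniH iM jM (cP i iM) (cP j jM) (esym HE).
Qed.

End CrossingPoints.

(** Because q = 1 modulo k. *)
Lemma dvdn_strands (p q h v : nat) : (0 < q)%N -> (p %| h + v * q)%N ->
  (gcdn (q - 1) p %| h + v)%N.
Proof.
move=> q0 closing; have kp := dvdn_trans (dvdn_gcdr (q - 1) p) closing.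
have kq : (gcdn (q - 1) p %| v * (q - 1))%N by rewrite dvdn_mull // dvdn_gcdl.
have E : (h + v * q = h + v + v * (q - 1))%N by nia.
by move: kp; rewrite E dvdn_addl.
Qed.

Section SpecialKnotDiagram.
Variable R : realType.
Variables (p q h v : nat) (f : R -> R) (lo hi m : nat -> R).
Local Notation beta := (box R p).
Hypothesis p_gt0 : (0 < p)%N.
Hypothesis q_gt0 : (0 < q)%N.
Hypothesis h_gt0 : (0 < h)%N.
Hypothesis v_lt : (v < p)%N.
Hypothesis closing : (p %| h + v * q)%N.
Hypothesis fp : front_profile f beta h v lo hi m.
Local Notation n := (h + v)%N.
Local Notation k := (gcdn (q - 1) p).
Local Notation M := (n %/ k)%N.
Local Notation kn := (knot p q (fp_neg fp)).

Lemma box_gt0 : 0 < beta.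
Proof. by rewrite divr_gt0 ?mulr_gt0 ?pi_gt0 ?ltr0n. Qed.

Let strands_whole : (k * M = n)%N.
Proof. by rewrite mulnC divnK // (dvdn_strands q_gt0 closing). Qed.

Lemma azimuth_turn : (p %/ k)%:R * (k%:R * beta) = pi *+ 2.
Proof.
have pN0 : p%:R != 0 :> R by rewrite pnatr_eq0 -lt0n.
by rewrite mulrA -natrM divnK ?dvdn_gcdr // /box -mulr_natl; field.
Qed.

Section Inverse.
Variable X : R -> R.
Hypotheses (tauX : forall t, orbit_angle f (X t) = t) (Xtau : forall x, X (orbit_angle f x) = x).
Hypotheses (cX : continuous X) (Xmono : forall s t, (s < t) = (X s < X t)).
Local Notation H := (front_height f X).
Local Notation a := (orbit_angle f (lo 0)).
Local Notation b := (orbit_angle f (hi 0)).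
Local Notation kappa := (k%:R * beta).
Local Notation T := (n%:R * beta).

Let uniH : unimodal H kappa T M a b.
Proof. exact: (front_unimodal fp box_gt0 h_gt0 tauX Xtau cX Xmono strands_whole). Qed.

Let projX t : lagrangian_proj (kn (X t)) = cylinder (p %/ k)%:R t (H t).
Proof. by rewrite knot_proj // tauX. Qed.

Let knX_turn t : kn (X (t + T)) = kn (X t).
Proof.
rewrite (front_inverse_turn fp tauX Xtau).
exact: (knot_turn p_gt0 (fp_neg fp) v_lt closing (fp_turn fp)).
Qed.

Lemma knot_diagram : lagrangian_diagram (range kn) = wound_graph H (p %/ k)%:R.
Proof.
apply/seteqP; split=> [_ [_ [x _ <-] <-]|_ [t _ <-]].
  by exists (orbit_angle f x) => //; rewrite -projX Xtau.
by exists (kn (X t)); [exists (X t)|rewrite projX].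
Qed.

Lemma knot_embedded_at_crossing i c : (0 < i < M)%N ->
  crossing_at H kappa T a b i c -> kn (X c) <> kn (X (c + i%:R * kappa)).
Proof.
move=> /andP[i0 iM] [/andP[ac cb] /andP[bc ca] Hc] /knot_eq.
move=> /(_ p_gt0)[A [B [xE fE]]].
have kap0 := uni_kappa uniH.
have D := shift_ltT uniH iM; have D0 := shift_lt uniH i0; rewrite mul0r add0r in D0.
have le := front_inverse_le Xmono.
have loT : a + T = orbit_angle f (lo n) by rewrite (fp_close fp) (orbit_angle_turn fp).
rewrite loT in ca.
apply: (front_no_lattice_chord fp box_gt0 h_gt0 _ _ _ _ _ xE fE).
- by rewrite -[lo 0]Xtau -[hi 0]Xtau -!le ac.
- by rewrite -[hi 0]Xtau -[lo n]Xtau -!le bc.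
- by rewrite -Xmono; lra.
- by rewrite -(front_inverse_turn fp tauX Xtau) -Xmono; lra.
- by apply: slope_height_inj (Hc); apply: lt_trans (fp_neg fp _) _; exact: ltr01.
Qed.

Lemma knot_crossings :
  crossings (range kn) = crossing_points H kappa T M a b (p %/ k)%:R.
Proof.
have Hb := front_height_bound fp X.
apply/seteqP; split=> [w [_ [_ [[x _ <-] [y _ <-] xy xw yw]]]|w [i [c [iM cc ->]]]].
  have [u xE] : exists u, x = X u by exists (orbit_angle f x); rewrite Xtau.
  have [t yE] : exists t, y = X t by exists (orbit_angle f y); rewrite Xtau.
  subst x y; rewrite projX in xw; rewrite projX -xw in yw.
  have [HE [e uE]] := cylinder_inj azimuth_turn (Hb t) yw.
  have Hper : forall s (j : int), H (s + j%:~R * T) = H s := unimodal_periodz uniH.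
  have kper : forall (j : int) s, kn (X (s + j%:~R * T)) = kn (X s) := periodic_intr knX_turn.
  have M0 := uni_turns uniH; have TE := uni_total uniH.
  have eM := divz_eq e M.
  have : (e %% M < M)%Z by rewrite ltz_pmod.
  have : (0 <= e %% M)%Z by rewrite modz_ge0 // eqz_nat -lt0n.
  case: (e %% M)%Z eM => // i eE _; rewrite ltz_nat => iM.
  have uE' : u = t + i%:R * kappa + (e %/ M)%Z%:~R * T.
    have eR : e%:~R = (e %/ M)%Z%:~R * M%:R + i%:R :> R by rewrite {1}eE intrD intrM.
    by rewrite uE eR TE; ring.
  have i0 : (0 < i)%N.
    rewrite lt0n; apply/eqP => i0; apply: xy.
    by rewrite uE' kper i0 mul0r addr0.
  have Ht : H t = strand H kappa t i by rewrite /strand -HE uE' Hper.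
  have iM' : (0 < i < M)%N by rewrite i0.
  have [l [j [c [jM cc side]]]] := crossing_reduce uniH iM' Ht.
  exists j, c; split=> //; have [_ _ Hc] := cc.
  have perT s d : cylinder (p %/ k)%:R (s + d%:~R * T) (H (s + d%:~R * T)) =
      cylinder (p %/ k)%:R s (H s).
    rewrite Hper; have -> : d%:~R * T = (d * M%:Z)%:~R * kappa by rewrite TE intrM -mulrA.
    exact: (cylinder_periodz azimuth_turn).
  case: side => side; first by rewrite -xw -yw side perT.
  by rewrite -xw uE' side -addrA -mulrDl -intrD perT.
exists (kn (X c)), (kn (X (c + i%:R * kappa))); split.
- by exists (X c).
- by exists (X (c + i%:R * kappa)).
- exact: knot_embedded_at_crossing.
- by rewrite projX.
rewrite projX; have [_ _ Hc] := cc; rewrite Hc /strand.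
exact: (cylinder_periodz azimuth_turn c _ i).
Qed.

End Inverse.

Lemma knot_diagram_count :
  crossings (@legendrian_of_front R p q f) #= [set i : nat | (0 < i < M)%N] /\
  regions (@legendrian_of_front R p q f) #= `I_M.+1.
Proof.
have [X [tauX Xtau cX Xmono]] := front_inverse fp.
have uniH := front_unimodal fp box_gt0 h_gt0 tauX Xtau cX Xmono strands_whole.
have Hb := front_height_bound fp X.
rewrite (legendrian_of_frontE p q (fp_neg fp)); split.
  rewrite (knot_crossings tauX Xtau cX Xmono).
  exact: (card_crossing_points uniH azimuth_turn Hb).
rewrite /regions (knot_diagram tauX Xtau).
exact: (card_complement_components uniH azimuth_turn Hb).
Qed.

End SpecialKnotDiagram.

Lemma card_between (M : nat) : (0 < M)%N ->
  [set i : nat | (0 < i < M)%N] #= `I_M.-1.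
Proof.
move=> M0; have -> : [set i : nat | (0 < i < M)%N] = S @` `I_M.-1.
  apply/seteqP; split=> [[|i] //= iM|_ [i /= iM <-] /=]; last by lia.
  by exists i => //=; lia.
by apply: inj_card_eq => i j _ _ [].
Qed.

(** An index x stands for the shift by x and an index y for the shift by
    h + v - y; together they run through the multiples of k between 0 and
    h + v = k M. *)
Lemma card_crossing_index (k M h v : nat) : (0 < k)%N -> (0 < h)%N -> (k * M = h + v)%N ->
  crossing_index k h v #= [set i : nat | (0 < i < M)%N].
Proof.
move=> k0 h0 kM; pose g (i : nat + nat) := match i with
  | inl x => (x %/ k)%N | inr y => (M - y %/ k)%N end.
have -> : [set i : nat | (0 < i < M)%N] = g @` crossing_index k h v.
  apply/seteqP; split=> [i /= /andP[i0 iM]|_ [[x|y] /= + <-]].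
  - have [ih|hi] := ltnP (k * i) h.
      exists (inl (k * i)%N); rewrite /= ?mulKn // ih dvdn_mulr // muln_gt0 k0 i0.
      by [].
    exists (inr (k * (M - i))%N); rewrite /= ?mulKn ?dvdn_mulr //; last by lia.
    rewrite muln_gt0 k0 subn_gt0 iM mulnBr kM /= andbT; lia.
  - move=> /and3P[x0 xh /dvdnP[c xE]]; rewrite xE mulnK //.
    have c0 : (0 < c)%N by rewrite -(ltn_pmul2r k0); lia.
    have cM : (c < M)%N by rewrite -(ltn_pmul2r k0); lia.
    by rewrite c0.
  - move=> /and3P[y0 yv /dvdnP[c yE]]; rewrite yE mulnK //.
    have c0 : (0 < c)%N by rewrite -(ltn_pmul2r k0); lia.
    have cM : (c < M)%N by rewrite -(ltn_pmul2r k0); lia.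
    lia.
apply/card_esym/inj_card_eq => -[x|y] [x'|y']; rewrite !inE /=.
- move=> /and3P[_ _ /dvdnP[c ->]] /and3P[_ _ /dvdnP[c' ->]].
  by rewrite !mulnK // => ->.
- move=> /and3P[_ ch /dvdnP[c cE]] /and3P[_ cv /dvdnP[c' cE']].
  subst x y'; rewrite !mulnK // => E; exfalso.
  have c'M : (c' <= M)%N by rewrite -(leq_pmul2r k0); lia.
  have : (c * k + c' * k = M * k)%N by rewrite -mulnDl E subnK.
  lia.
- move=> /and3P[_ cv /dvdnP[c cE]] /and3P[_ ch /dvdnP[c' cE']].
  subst y x'; rewrite !mulnK // => E; exfalso.
  have cM : (c <= M)%N by rewrite -(leq_pmul2r k0); lia.
  have : (c' * k + c * k = M * k)%N by rewrite -mulnDl -E subnK.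
  lia.
move=> /and3P[_ cv /dvdnP[c cE]] /and3P[_ cv' /dvdnP[c' cE']].
subst y y'; rewrite !mulnK // => E.
have cM : (c <= M)%N by rewrite -(leq_pmul2r k0); lia.
have cM' : (c' <= M)%N by rewrite -(leq_pmul2r k0); lia.
by congr (inr (_ * _)%N); lia.
Qed.

Theorem theorem5 (R : realType) (p q h v : nat)
    (q_gt1 : (1 < q)%N) (q_lt_p : (q < p)%N) (coprime_qp : coprime q p)
    (grid_hv : grid_number_one p q h v) (prim : primitive p h) :
  let k := gcdn (q - 1) p in
  exists2 eps : R, 0 < eps &
    forall K0 : set (lens R p q), special_knot h v eps K0 ->
      (crossings K0 #= crossing_index k h v) /\
      (exists N : nat,
         (crossings K0 #= `I_N) /\
         (regions K0 #= `I_N.+2)).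
Proof.
move=> k.
have [s [vs [/andP[s0 sp] _ hE [/andP[v0 vp] closing]]]] := grid_hv.
have h0 : (0 < h)%N by case: hE => -[_ ->]; rewrite ?subn_gt0.
have p0 : (0 < p)%N by lia.
have q0 : (0 < q)%N by lia.
exists (box R p / (8 * h%:R)).
  by rewrite divr_gt0 ?(box_gt0 R p0) // mulr_gt0 // ltr0n.
move=> _ [f front ->].
have [lo [hi [m fp]]] := special_front_profile p0 h0 v0 erefl front.
have [cr rg] := knot_diagram_count p0 q0 h0 vp closing fp.
have k0 : (0 < k)%N by rewrite gcdn_gt0 p0 orbT.
have kM : (k * ((h + v) %/ k) = h + v)%N by rewrite mulnC divnK // dvdn_strands.
have M0 : (0 < (h + v) %/ k)%N by rewrite -(ltn_pmul2l k0) muln0 kM addn_gt0 h0.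
split; first exact: card_eq_trans cr (card_esym (card_crossing_index k0 h0 kM)).
exists ((h + v) %/ k).-1; split.
  exact: card_eq_trans cr (card_between M0).
by rewrite prednK.
Qed.
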